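(* Let $k$ be a field of characteristic zero and $R=k[s,t,x,y,z]$, bigraded with $\deg s=\deg t=(1,0)$ and $\deg x=\deg y=\deg z=(0,1)$, so $R$ is the coordinate ring of $\mathbb P^1\times\mathbb P^2$. Let $Z$ be a set of fat lines in $\mathbb P^1\times\mathbb P^2$ with partition $Z=Z_1\cup Z_2$ into horizontal and vertical components, satisfying: (a) $Z_1$ is non-empty and all its lines are reduced (multiplicity $1$); (b) if $\mathbb V(A,B),\mathbb V(A',B)$ are horizontal lines of $Z$ then $(A)=(A')$. Assume moreover that all horizontal lines lie in one hyperplane $\mathbb V(A)$, so that $Z_1=\mathbb V(A,B_1)\cup\cdots\cup\mathbb V(A,B_N)$, and set $F=B_1B_2\cdots B_N\in k[x,y,z]$. Then $Z$ is ACM if and only if the ideal $I_{Z_2}+(F)$ is saturated in $k[x,y,z]$ (here $I_{Z_2}$ is generated by forms in $x,y,z$ only and is regarded as an ideal of $k[x,y,z]$).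
   Context: Elements of $R_{(1,0)}$ are denoted $A,A',\dots$ and elements of $R_{(0,1)}$ are denoted $B,B',\dots$ (all nonzero). A horizontal line is $\mathbb V(A,B)$ with $A\in R_{(1,0)}$, $B\in R_{(0,1)}$, with ideal $(A,B)$; a vertical line is $\mathbb V(B,B')$ with $B,B'\in R_{(0,1)}$ linearly independent, with ideal $(B,B')$. A set of fat lines $Z=m_1L_1+\cdots+m_nL_n$ (distinct lines $L_i$, positive integers $m_i$) is the subscheme with bihomogeneous ideal $I_Z=\bigcap_i I_{L_i}^{m_i}$; $Z_1$ consists of the horizontal components and $Z_2$ of the vertical components (with their multiplicities). $Z$ is ACM (arithmetically Cohen–Macaulay) if $R/I_Z$ is a Cohen–Macaulay ring. Saturation in $k[x,y,z]$ is with respect to $(x,y,z)$. *)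

(* Defs.v *)
From HB Require Import structures.
From mathcomp Require Import all_boot all_order all_algebra.
From mathcomp Require Import mpoly.
From Stdlib Require List.
Set Implicit Arguments. Unset Strict Implicit. Unset Printing Implicit Defensive.
Import GRing.Theory.
Local Open Scope ring_scope.

Section Ideals.
Variable T : comNzRingType.

Definition ideal_gen (G : T -> Prop) : T -> Prop :=
  fun f => exists l : seq (T * T),
    (forall p, p \in l -> G p.2) /\ f = \sum_(p <- l) p.1 * p.2.

Definition is_ideal (I : T -> Prop) : Prop :=
  [/\ I 0, (forall a b, I a -> I b -> I (a + b)) & (forall r a, I a -> I (r * a))].

Definition ideal_sub (I J : T -> Prop) : Prop := forall f, I f -> J f.

Definition ideal_eq (I J : T -> Prop) : Prop := forall f, I f <-> J f.

Definition ideal_prod (I J : T -> Prop) : T -> Prop :=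
  ideal_gen (fun h => exists a b, [/\ I a, J b & h = a * b]).

Definition ideal_pow (I : T -> Prop) (n : nat) : T -> Prop :=
  iter n (ideal_prod I) (ideal_gen (fun h => h = 1)).

Definition prime_ideal (P : T -> Prop) : Prop :=
  [/\ is_ideal P, ~ P 1 & forall a b, P (a * b) -> P a \/ P b].

Definition maximal_ideal (M : T -> Prop) : Prop :=
  [/\ is_ideal M, ~ M 1 &
     forall J, is_ideal J -> ideal_sub M J -> ideal_sub J M \/ J 1].

(* contraction to T of the extension of J to the localization T_m *)
Definition loc_contr (J m : T -> Prop) : T -> Prop :=
  fun g => exists u, ~ m u /\ J (u * g).

Definition ideal_add_seq (I : T -> Prop) (fs : seq T) : T -> Prop :=
  ideal_gen (fun h => I h \/ h \in fs).

(* fs is a regular sequence on the local ring (T/I)_m, with entries in m *)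
Definition regular_seq (I m : T -> Prop) (fs : seq T) : Prop :=
  (forall i, (i < size fs)%N ->
     m fs`_i /\
     forall g, loc_contr (ideal_add_seq I (take i fs)) m (fs`_i * g) ->
               loc_contr (ideal_add_seq I (take i fs)) m g)
  /\ ~ loc_contr (ideal_add_seq I fs) m 1.

Definition depth_ge (I m : T -> Prop) (n : nat) : Prop :=
  exists fs, size fs = n /\ regular_seq I m fs.

Definition dim_ge (I m : T -> Prop) (n : nat) : Prop :=
  exists P : nat -> T -> Prop,
    [/\ forall i, (i <= n)%N -> prime_ideal (P i),
        forall i, (i < n)%N -> ideal_sub (P i) (P i.+1) /\ ~ ideal_sub (P i.+1) (P i),
        ideal_sub I (P 0%N) & ideal_sub (P n) m].

(* T/I is Cohen-Macaulay: for every maximal ideal m of T/I (i.e. maximal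
   ideal of T containing I), depth (T/I)_m = dim (T/I)_m, expressed as
   equality of the (downward closed) sets of attained lengths, i.e. of their
   suprema in N U {oo}. *)
Definition CohenMacaulay_quotient (I : T -> Prop) : Prop :=
  forall m, maximal_ideal m -> ideal_sub I m ->
    forall n, depth_ge I m n <-> dim_ge I m n.

Definition saturated_wrt (mm I : T -> Prop) : Prop :=
  forall f, (exists n, forall g, ideal_pow mm n g -> I (f * g)) -> I f.

End Ideals.

Section FatLines.
Variable k : fieldType.

(* R = k[s,t,x,y,z]: variables 0 = s, 1 = t, 2 = x, 3 = y, 4 = z *)
Definition RR := {mpoly k[5]}.
(* S = k[x,y,z]: variables 0 = x, 1 = y, 2 = z *)
Definition SS := {mpoly k[3]}.

Definition vR (i : nat) : RR := 'X_(inord i).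
Definition vS (i : nat) : SS := 'X_(inord i).

Definition incl (p : SS) : RR := comp_mpoly [tuple vR 2; vR 3; vR 4] p.

Definition deg10 (A : RR) : Prop :=
  exists a b : k, (a != 0 \/ b != 0) /\ A = a *: vR 0 + b *: vR 1.

(* nonzero linear forms of k[x,y,z]; their images are exactly the
   nonzero elements of R_(0,1) *)
Definition lin01 (B : SS) : Prop :=
  exists a b c : k, (a != 0 \/ b != 0 \/ c != 0) /\
    B = a *: vS 0 + b *: vS 1 + c *: vS 2.

Inductive line : Type :=
  | Horiz of RR & SS
  | Vert of SS & SS.

Definition line_ok (L : line) : Prop :=
  match L with
  | Horiz A B => deg10 A /\ lin01 B
  | Vert B B' => [/\ lin01 B, lin01 B' &
                  forall a b : k, a *: B + b *: B' = 0 -> a = 0 /\ b = 0]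
  end.

Definition line_ideal (L : line) : RR -> Prop :=
  match L with
  | Horiz A B => ideal_gen (fun h => h = A \/ h = incl B)
  | Vert B B' => ideal_gen (fun h => h = incl B \/ h = incl B')
  end.

Definition is_horiz (L : line) : bool :=
  if L is Horiz _ _ then true else false.

Definition fat_lines_ok (Z : seq (line * nat)) : Prop :=
  (forall p, List.In p Z -> line_ok p.1 /\ (0 < p.2)%N) /\
  (forall i j, (i < size Z)%N -> (j < size Z)%N -> i <> j ->
     ~ ideal_eq (line_ideal (nth (Vert 0 0, 0%N) Z i).1)
                (line_ideal (nth (Vert 0 0, 0%N) Z j).1)).

Definition fat_ideal (Z : seq (line * nat)) : RR -> Prop :=
  fun f => forall p, List.In p Z -> ideal_pow (line_ideal p.1) p.2 f.

Definition Z1 (Z : seq (line * nat)) := [seq p <- Z | is_horiz p.1].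
Definition Z2 (Z : seq (line * nat)) := [seq p <- Z | ~~ is_horiz p.1].

Definition ACM (Z : seq (line * nat)) : Prop :=
  CohenMacaulay_quotient (fat_ideal Z).

Definition horizF (Z : seq (line * nat)) : SS :=
  \prod_(p <- Z) (if p.1 is Horiz _ B then B else 1).

Definition IZ2_S (Z : seq (line * nat)) : SS -> Prop :=
  fun g => fat_ideal (Z2 Z) (incl g).

Definition irrS : SS -> Prop :=
  ideal_gen (fun h => h = vS 0 \/ h = vS 1 \/ h = vS 2).

End FatLines.

(* Main.v *)
(* Let [S = k[x,y,z]], let [sigma] be the form cutting out the hyperplane, [tau] a
   complementary form of degree [(1,0)], [J] the ideal of the vertical lines in [S]
   and [H = J + (F)]. Then [I_Z = (sigma, F) /\ J[sigma,tau]], whose quotient has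
   dimension 3 and sits in the exact sequence
     [0 -> R/I_Z -> R/(sigma,F) + R/JR -> S/H [tau] -> 0].

   If [H] is saturated, a general linear form [l] is regular modulo [H]. By Zariski's
   lemma every maximal ideal contains [q1(l)], [q2(sigma + l')] and [q3(tau)] for some
   monic [q1, q2, q3] in one variable, and these form a regular sequence on [R/I_Z] for
   general linear forms [l, l']; so the depth is 3 at every maximal ideal.

   Conversely, if [irr * g] lies in [H], write [l g = j + F b]; then [sigma g + F b] is
   killed by [(s,t,x,y,z)] modulo the regular sequence [sigma + l, tau] on [R/I_Z].
   Depth 3 at the origin makes this socle element vanish, hence [g] lies in [H]. *)

Require Import Defs.
From HB Require Import structures.
From mathcomp Require Import all_boot all_order all_algebra.
From mathcomp Require Import mpoly.
From Stdlib Require List.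
From mathcomp Require Import ring zify.
From mathcomp Require boolp classical_sets.
Import GRing.Theory.
Local Open Scope ring_scope.
Set Implicit Arguments.
Unset Strict Implicit.
Unset Printing Implicit Defensive.

(** * Ideals, minimal primes and regular sequences *)

(** Cohen-Macaulayness is tested at every maximal ideal of [R], over a field that need not be
    algebraically closed. A linear form need not lie in such an ideal, but some monic polynomial in
    it does; hence the elements [q(l)], and regularity criteria for monic polynomials in place of
    homogeneous ones. The second element is shifted by [l'] because [sigma] itself vanishes on
    [R/(sigma,F)].

    Exact sequences, Ext and dimension formulas are replaced by computations with elements. The
    upper bound on the dimension counts monomials. The lower bound at the origin, without which the
    equality of depth and dimension would not yield depth 3, comes from the saturated case applied
    to [Z_1] alone: without vertical lines [H] is the unit ideal, so [(sigma,F)] has depth 3, and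
    depth never exceeds dimension. In the converse the regular sequence supplied by depth 3 is
    unknown, while the socle element lives modulo [(sigma + l, tau)]; Koszul relations compare the
    two. *)

Section IdealTheory.
Variable T : comNzRingType.
Implicit Types (I J K P m : T -> Prop).

Lemma ideal0 I : is_ideal I -> I 0. Proof. by case. Qed.
Lemma idealD I a b : is_ideal I -> I a -> I b -> I (a + b).
Proof. by case=> _ H _; apply: H. Qed.
Lemma idealM I r a : is_ideal I -> I a -> I (r * a).
Proof. by case=> _ _ H; apply: H. Qed.
Lemma idealMr I r a : is_ideal I -> I a -> I (a * r).
Proof. by rewrite mulrC; apply: idealM. Qed.
Lemma idealN I a : is_ideal I -> I a -> I (- a).
Proof. by move=> iI Ia; rewrite -mulN1r; apply: idealM. Qed.
Lemma idealB I a b : is_ideal I -> I a -> I b -> I (a - b).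
Proof. by move=> iI Ia Ib; apply: idealD => //; apply: idealN. Qed.
Lemma ideal_sum I (X : Type) (r : seq X) (Q : pred X) (F : X -> T) :
  is_ideal I -> (forall x, Q x -> I (F x)) -> I (\sum_(x <- r | Q x) F x).
Proof.
move=> iI IF; elim/big_ind: _ => //; first exact: ideal0.
by move=> x y; apply: idealD.
Qed.

Lemma mem_ideal_gen (G : T -> Prop) h : G h -> ideal_gen G h.
Proof.
move=> Gh; exists [:: (1, h)]; split; last by rewrite big_seq1 mul1r.
by move=> p; rewrite inE => /eqP ->.
Qed.

Lemma ideal_gen_ideal (G : T -> Prop) : is_ideal (ideal_gen G).
Proof.
split.
- by exists [::]; rewrite big_nil.
- move=> a b [l [Gl ->]] [l' [Gl' ->]]; exists (l ++ l').
  by rewrite big_cat; split=> // p; rewrite mem_cat => /orP [/Gl|/Gl'].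
- move=> r a [l [Gl ->]]; exists [seq (r * p.1, p.2) | p <- l]; split.
    by move=> p /mapP [q /Gl Gq ->].
  by rewrite big_map mulr_sumr; apply: eq_bigr => i _; rewrite mulrA.
Qed.
Hint Resolve ideal_gen_ideal : core.

Lemma ideal_gen_min (G : T -> Prop) I :
  is_ideal I -> (forall h, G h -> I h) -> ideal_sub (ideal_gen G) I.
Proof.
move=> iI GI f [l [Gl ->]]; rewrite big_seq; apply: ideal_sum => // p /Gl.
by move/GI; apply: idealM.
Qed.

Lemma ideal_genS (G G' : T -> Prop) :
  (forall h, G h -> ideal_gen G' h) -> ideal_sub (ideal_gen G) (ideal_gen G').
Proof. by move=> GG'; apply: ideal_gen_min. Qed.

Lemma ideal_gen1P (h f : T) :
  ideal_gen (fun x => x = h) f <-> exists c, f = c * h.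
Proof.
split=> [|[c ->]]; last by apply: idealM => //; apply: mem_ideal_gen.
apply: (@ideal_gen_min _ (fun x => exists c, x = c * h)) => [|_ ->]; last by exists 1; rewrite mul1r.
split=> [|_ _ [a ->] [b ->]|r _ [a ->]]; first by exists 0; rewrite mul0r.
  by exists (a + b); rewrite mulrDl.
by exists (r * a); rewrite mulrA.
Qed.

Lemma ideal_gen2P (h h' f : T) :
  ideal_gen (fun x => x = h \/ x = h') f <-> exists c d, f = c * h + d * h'.
Proof.
split=> [|[c [d ->]]]; last first.
  by apply: idealD => //; apply: idealM => //; apply: mem_ideal_gen; [left|right].
apply: (@ideal_gen_min _ (fun x => exists c d, x = c * h + d * h')) => [|_ [] ->].
- split=> [|_ _ [a [b ->]] [a' [b' ->]]|r _ [a [b ->]]].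
  + by exists 0, 0; ring.
  + by exists (a + a'), (b + b'); ring.
  + by exists (r * a), (r * b); ring.
- by exists 1, 0; ring.
- by exists 0, 1; ring.
Qed.

Lemma ideal_genUP I h f : is_ideal I ->
  ideal_gen (fun x => I x \/ x = h) f <-> exists c d, I c /\ f = c + d * h.
Proof.
move=> iI; split=> [|[c [d [Ic ->]]]]; last first.
  by apply: idealD => //; [|apply: idealM => //]; apply: mem_ideal_gen; [left|right].
apply: (@ideal_gen_min _ (fun x => exists c d, I c /\ x = c + d * h)) => [|x [Ix| ->]].
- split=> [|_ _ [a [b [Ia ->]]] [a' [b' [Ia' ->]]]|r _ [a [b [Ia ->]]]].
  + by exists 0, 0; split; [apply: ideal0|ring].
  + by exists (a + a'), (b + b'); split; [apply: idealD|ring].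
  + by exists (r * a), (r * b); split; [apply: idealM|ring].
- by exists x, 0; split=> //; ring.
- by exists 0, 1; split; [apply: ideal0|ring].
Qed.

Lemma ideal_add_seq_nilP I f : is_ideal I -> ideal_add_seq I [::] f <-> I f.
Proof.
move=> iI; split=> [|If]; last by apply: mem_ideal_gen; left.
by apply: ideal_gen_min => // h [].
Qed.

Lemma ideal_add_seq_rconsP I s h f : is_ideal I ->
  ideal_add_seq I (rcons s h) f <->
  exists c d, ideal_add_seq I s c /\ f = c + d * h.
Proof.
move=> iI; apply: iff_trans (ideal_genUP h f (ideal_gen_ideal _)).
split; move: f; apply: ideal_genS.
- move=> x [Ix|]; first by apply/mem_ideal_gen; left; apply/mem_ideal_gen; left.
  rewrite mem_rcons inE => /orP [/eqP ->|xs]; apply/mem_ideal_gen; first by right.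
  by left; apply/mem_ideal_gen; right.
- move=> x [| ->]; last by apply/mem_ideal_gen; right; rewrite mem_rcons mem_head.
  move: x; apply: ideal_genS => x [Ix|xs]; apply/mem_ideal_gen; first by left.
  by right; rewrite mem_rcons inE xs orbT.
Qed.

Lemma ideal_add_seq_sub I s J : is_ideal J -> ideal_sub I J ->
  (forall x, x \in s -> J x) -> ideal_sub (ideal_add_seq I s) J.
Proof. by move=> iJ IJ sJ; apply: ideal_gen_min => // h [/IJ|/sJ]. Qed.

Lemma prime_ideal_ideal P : prime_ideal P -> is_ideal P. Proof. by case. Qed.

Lemma prime_idealX P a n : prime_ideal P -> P (a ^+ n) -> P a.
Proof.
case=> _ P1 PM; elim: n => [|n IHn]; first by rewrite expr0.
by rewrite exprS => /PM [].
Qed.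

Lemma maximal_ideal_prime m : maximal_ideal m -> prime_ideal m.
Proof.
case=> im m1 mm; split=> // a b mab; apply: boolp.contrapT => /boolp.not_orP [ma mb].
have [||nJ|] := mm (ideal_gen (fun x => m x \/ x = a)).
- exact: ideal_gen_ideal.
- by move=> f mf; apply: mem_ideal_gen; left.
- by apply: ma; apply: nJ; apply: mem_ideal_gen; right.
move/(ideal_genUP _ _ im) => [c [d [mc E]]]; apply: mb.
have -> : b = b * c + d * (a * b).
  by transitivity (b * (c + d * a)); [rewrite -E mulr1|ring].
by apply: idealD => //; apply: idealM.
Qed.

Lemma maximal_ideal_inv m a : maximal_ideal m -> ~ m a -> exists b, m (a * b - 1).
Proof.
case=> im m1 mm ma.
have [||nJ|] := mm (ideal_gen (fun x => m x \/ x = a)).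
- exact: ideal_gen_ideal.
- by move=> f mf; apply: mem_ideal_gen; left.
- by case: ma; apply: nJ; apply: mem_ideal_gen; right.
move/(ideal_genUP _ _ im) => [c [d [mc E]]]; exists d.
by rewrite E (_ : _ - _ = - c); [apply: idealN|ring].
Qed.

(* Zorn: an ideal maximal among those missing the multiplicative set
   [u * f ^+ e], [u] outside [P], is prime. *)
Lemma prime_below I P f : is_ideal I -> prime_ideal P ->
  (forall u e, ~ P u -> ~ I (u * f ^+ e)) ->
  exists Q, [/\ prime_ideal Q, ideal_sub I Q, ideal_sub Q P & ~ Q f].
Proof.
move=> iI [iP P1 PM] avoid.
pose good (X : T -> Prop) :=
  [/\ is_ideal X, ideal_sub I X & forall u e, ~ P u -> ~ X (u * f ^+ e)].
pose fam (X : T -> Prop) := (forall x, ~ X x) \/ good X.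
have [|A [famA Amax]] := @classical_sets.Zorn_bigcup T fam.
  move=> F Ffam Ftot.
  have [[X0 [FX0 gX0]]|nF] := boolp.EM (exists X, F X /\ good X); last first.
    left=> x [X FX Xx]; have [/(_ x)//|gX] := Ffam X FX.
    by apply: nF; exists X.
  have gF X x : F X -> X x -> good X.
    by move=> FX Xx; have [/(_ x)|] := Ffam X FX.
  right; split.
  - split.
    + by exists X0 => //; case: gX0 => /ideal0.
    + move=> a b [X FX Xa] [Y FY Yb]; have [iX _ _] := gF _ _ FX Xa.
      have [iY _ _] := gF _ _ FY Yb.
      by have [XY|YX] := Ftot X Y FX FY; [exists Y => //|exists X => //];
        apply: idealD => //; [apply: XY|apply: YX].
    + move=> r a [X FX Xa]; have [iX _ _] := gF _ _ FX Xa.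
      by exists X => //; apply: idealM.
  - by move=> x Ix; exists X0 => //; case: gX0 => _ + _; apply.
  - by move=> u e Pu [X FX Xu]; case: (gF _ _ FX Xu) => _ _ /(_ u e Pu).
have gI : good I by split.
case: famA => [A0|[iA IA avA]].
  case: (Amax I); last by right.
  by split=> [x /A0//|IA]; apply: (A0 0); apply: IA; apply: ideal0.
have ext a : ~ A a -> exists u e x r, [/\ ~ P u, A x & u * f ^+ e = x + r * a].
  move=> Aa; apply: boolp.contrapT => no.
  apply: (Amax (ideal_gen (fun x => A x \/ x = a))).
    split=> [x Ax|]; first by apply: mem_ideal_gen; left.
    by move=> sub; apply: Aa; apply: sub; apply: mem_ideal_gen; right.
  right; split=> //; first by move=> x /IA Ax; apply: mem_ideal_gen; left.
  move=> u e Pu /(ideal_genUP _ _ iA) [x [r [Ax E]]].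
  by apply: no; exists u, e, x, r.
exists A; split=> //.
- split=> //.
    by move=> A1; apply: (avA 1 0%N P1); rewrite expr0 mulr1.
  move=> a b Aab; apply: boolp.contrapT => /boolp.not_orP [/ext + /ext].
  move=> [u [e [x [r [Pu Ax E]]]]] [u' [e' [x' [r' [Pu' Ax' E']]]]].
  apply: (avA (u * u') (e + e')%N); first by case/PM.
  have -> : u * u' * f ^+ (e + e') = (u * f ^+ e) * (u' * f ^+ e').
    by rewrite exprD; ring.
  rewrite E E' (_ : _ * _ = (x' + r' * b) * x + (r * a) * x' + r * r' * (a * b));
    last by ring.
  by apply: idealD => //; [apply: idealD => //|]; apply: idealM.
- move=> x Ax; apply: boolp.contrapT => Px.
  by apply: (avA x 0%N Px); rewrite expr0 mulr1.
- by move=> Af; apply: (avA 1 1%N P1); rewrite expr1 mul1r.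
Qed.

(** If [f] is regular modulo [I'] locally at [m], every prime between [I' + (f)] and [m] strictly
    contains a prime over [I'] that misses [f]. Going through the sequence backwards gives one new
    prime per element. *)
Lemma depth_ge_dim_ge I m n : is_ideal I -> prime_ideal m -> ideal_sub I m ->
  depth_ge I m n -> dim_ge I m n.
Proof.
move=> iI pm Im [fs [sz [reg _]]]; have im := prime_ideal_ideal pm.
(* The chain grows downwards from [m]; its bottom prime contains the first [n - j] elements, which
   leaves room to descend. *)
suff H : forall j, (j <= n)%N -> exists P : nat -> T -> Prop,
    [/\ forall i, (i <= j)%N -> prime_ideal (P i),
        forall i, (i < j)%N -> ideal_sub (P i) (P i.+1) /\ ~ ideal_sub (P i.+1) (P i),
        ideal_sub (ideal_add_seq I (take (n - j) fs)) (P 0%N) & ideal_sub (P j) m].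
- have [P [? ? sub ?]] := H n (leqnn n); exists P; split=> // x Ix.
  by apply: sub; apply: mem_ideal_gen; left.
elim=> [|j IHj] jn.
  exists (fun _ => m); split=> // x; apply: ideal_add_seq_sub => // y /mem_take.
  by move/(nthP 0) => [i si <-]; case: (reg i si).
have [P [prP ltP subP Pm]] := IHj (ltnW jn).
have lt : (n - j.+1 < size fs)%N by rewrite sz -subSn // subSS leq_subr.
have E : (n - j = (n - j.+1).+1)%N by rewrite -subSn.
rewrite E (take_nth 0 lt) in subP.
set f := fs`_(n - j.+1) in subP; pose I' := ideal_add_seq I (take (n - j.+1) fs).
have prP0 := prP 0%N isT.
have P0m : forall i, (i <= j)%N -> ideal_sub (P i) m.
  move=> i ij; have [d] := ubnP (j - i); elim: d i ij => // d IHd i ij.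
  move: ij; rewrite leq_eqVlt => /orP [/eqP -> //|ij] ld x Px.
  apply: (IHd i.+1) => //; last by case: (ltP i ij) => H _; apply: H.
  by rewrite -ltnS (leq_trans _ ld) // ltnS subnS prednK // subn_gt0.
have I'P : ideal_sub I' (P 0%N).
  move=> x Ix; apply: subP; apply/(ideal_add_seq_rconsP _ _ _ iI).
  by exists x, 0; split=> //; ring.
have [||Q [prQ IQ QP Qf]] := @prime_below I' (P 0%N) f _ prP0.
- exact: ideal_gen_ideal.
- move=> u e Pu Iu.
  (* Regularity cancels [f] one factor at a time, at the cost of a denominator outside [m]; then [u]
     would lie in [P 0]. *)
  have [w [mw Iw]] : loc_contr I' m u.
    elim: e u Iu {Pu} => [|e IHe] u; rewrite ?mulr1 => Iu.
      by exists 1; rewrite mul1r; split=> //; case: pm.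
    have [|_ /(_ (u * f ^+ e)) []] := reg (n - j.+1)%N; first by [].
      exists 1; rewrite mul1r; split; first by case: pm.
      by rewrite -/f mulrCA -exprS.
    move=> w [mw]; rewrite mulrA => /IHe [w' [mw' Iw']].
    exists (w' * w); rewrite -mulrA; split=> //.
    by case: pm => _ _ H /H [].
  case: prP0 => _ _ /(_ w u (I'P _ Iw)) [Pw|//].
  by apply: mw; apply: (P0m 0%N).
exists (fun i => if i is i'.+1 then P i' else Q); split=> //.
- by case=> // i; apply: prP.
- case=> [_|i]; last exact: ltP.
  split=> // PQ; apply: Qf; apply: PQ; apply: subP.
  by apply: mem_ideal_gen; right; rewrite mem_rcons mem_head.
Qed.
End IdealTheory.

(** * Depth and the transfer of socle elements *)

Section Depth.
Variables (T : comNzRingType) (I m : T -> Prop).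
Hypotheses (iI : is_ideal I) (pm : prime_ideal m).

Let m1 : ~ m 1. Proof. by case: pm. Qed.
Let mM a b : ~ m a -> ~ m b -> ~ m (a * b).
Proof. by case: pm => _ _ H ma mb /H []. Qed.

Lemma ideal_add_seq1P f g :
  ideal_add_seq I [:: f] g <-> exists r, I (g - r * f).
Proof.
rewrite -[[:: f]]/(rcons [::] f); apply: iff_trans (ideal_add_seq_rconsP _ _ _ iI) _.
split=> [[c [d [/(ideal_add_seq_nilP _ iI) Ic ->]]]|[r Ir]].
  by exists d; rewrite (_ : _ - _ = c) //; ring.
by exists (g - r * f), r; split; [apply/(ideal_add_seq_nilP _ iI)|ring].
Qed.

Lemma ideal_add_seq2P f f' g :
  ideal_add_seq I [:: f; f'] g <-> exists r r', I (g - r * f - r' * f').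
Proof.
rewrite -[[:: f; f']]/(rcons [:: f] f').
apply: iff_trans (ideal_add_seq_rconsP _ _ _ iI) _.
split=> [[c [d [/ideal_add_seq1P [r Ic] ->]]]|[r [r' Ir]]].
  by exists r, d; rewrite (_ : _ - _ = c - r * f) //; ring.
exists (g - r' * f'), r'; split; last by ring.
by apply/ideal_add_seq1P; exists r; rewrite (_ : _ - _ = g - r * f - r' * f') //; ring.
Qed.

Lemma depth_ge_le n n' : (n' <= n)%N -> ideal_sub I m -> depth_ge I m n -> depth_ge I m n'.
Proof.
move=> le Im [fs [sz [reg _]]]; exists (take n' fs).
have sz' : size (take n' fs) = n' by rewrite size_takel // sz.
split=> //; split=> [i|].
  rewrite sz' => lt; rewrite nth_take // take_takel 1?ltnW //.
  by apply: reg; rewrite sz; apply: leq_trans le.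
case=> u [mu]; rewrite mulr1 => Iu; apply: mu; move: Iu.
apply: ideal_add_seq_sub => //; first by case: pm.
move=> x /mem_take /(nthP 0) [i lt <-].
by case: (reg i lt).
Qed.

(** Regularity over [T] itself survives localization: the denominator is carried along unchanged. *)
Lemma depth_ge3 f1 f2 f3 : ideal_sub I m -> m f1 -> m f2 -> m f3 ->
  (forall g, I (f1 * g) -> I g) ->
  (forall g, ideal_add_seq I [:: f1] (f2 * g) -> ideal_add_seq I [:: f1] g) ->
  (forall g, ideal_add_seq I [:: f1; f2] (f3 * g) -> ideal_add_seq I [:: f1; f2] g) ->
  depth_ge I m 3.
Proof.
move=> Im mf1 mf2 mf3 r1 r2 r3; exists [:: f1; f2; f3]; split=> //; split; last first.
  case=> u [mu]; rewrite mulr1 => Iu; apply: mu; move: Iu.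
  apply: ideal_add_seq_sub => //; first by case: pm.
  by move=> x; rewrite !inE => /or3P [] /eqP ->.
case=> [|[|[|//]]] _ /=; split=> // g [u [mu]]; rewrite mulrCA => H; exists u; split=> //.
- by apply/(ideal_add_seq_nilP _ iI)/r1/(ideal_add_seq_nilP _ iI).
- exact: r2.
- exact: r3.
Qed.

(* An element-level form of [Hom(k, M/(h1,h2)M) = Ext^2(k, M) =
   Hom(k, M/(f1,f2)M)] for [M = (T/I)_m]: the socle element [u] of [M/(h1,h2)]
   produces a socle element [v] of [M/(f1,f2)], which must vanish. *)
Lemma socle_exchange h1 h2 u :
  (forall g, I (h1 * g) -> I g) ->
  (forall g r, I (h2 * g - r * h1) -> exists r', I (g - r' * h1)) ->
  depth_ge I m 3 ->
  (forall r, m r -> exists c d, I (r * u - c * h1 - d * h2)) ->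
  exists w c d, ~ m w /\ I (w * u - c * h1 - d * h2).
Proof.
move=> reg1 reg2 [fs [sz [reg _]]] soc.
case: fs sz reg => [|f1 [|f2 [|f3 [|? ?]]]] // _ reg.
have [mf1 regf1] := reg 0%N isT; have [mf2 regf2] := reg 1%N isT.
have [mf3 regf3] := reg 2%N isT; rewrite /= in mf1 mf2 mf3 regf1 regf2 regf3.
have [a1 [b1 E1]] := soc _ mf1; have [a2 [b2 E2]] := soc _ mf2.
have [c3 [d3 E3]] := soc _ mf3.
(* Since [h1, h2] is regular modulo [I], its relations are the Koszul ones, multiples of
   [(-h2, h1)]. *)
have syz x y : I (x * h1 + y * h2) -> exists v, I (y - v * h1) /\ I (x + v * h2).
  move=> Ixy; have [|v Iv] := reg2 y (- x); first by rewrite (_ : _ - _ = x * h1 + y * h2) //; ring.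
  exists v; split=> //; apply: reg1.
  rewrite (_ : _ * _ = (x * h1 + y * h2) - h2 * (y - v * h1)); last by ring.
  by apply: idealB => //; apply: idealM.
have [|v [Vb Va]] := syz (f2 * a1 - f1 * a2) (f2 * b1 - f1 * b2).
  rewrite (_ : _ + _ = f1 * (f2 * u - a2 * h1 - b2 * h2) - f2 * (f1 * u - a1 * h1 - b1 * h2));
    last by ring.
  by apply: idealB => //; apply: idealM.
have [|e1 [Db1 _]] := syz (f3 * a1 - f1 * c3) (f3 * b1 - f1 * d3).
  rewrite (_ : _ + _ = f1 * (f3 * u - c3 * h1 - d3 * h2) - f3 * (f1 * u - a1 * h1 - b1 * h2));
    last by ring.
  by apply: idealB => //; apply: idealM.
have [|e2 [Db2 _]] := syz (f3 * a2 - f2 * c3) (f3 * b2 - f2 * d3).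
  rewrite (_ : _ + _ = f2 * (f3 * u - c3 * h1 - d3 * h2) - f3 * (f2 * u - a2 * h1 - b2 * h2));
    last by ring.
  by apply: idealB => //; apply: idealM.
(* The Koszul multipliers of the three pairs satisfy [f3 v = f2 e1 - f1 e2] modulo [I], as appears
   after multiplying by [h1]. Hence [v] vanishes locally modulo [(f1, f2)]. *)
have /regf3 [w [mw /ideal_add_seq2P [q [p Wv]]]] :
    loc_contr (ideal_add_seq I [:: f1; f2]) m (f3 * v).
  exists 1; split=> //; apply/ideal_add_seq2P; exists (- e2), e1; apply: reg1.
  rewrite (_ : _ * _ = f2 * (f3 * b1 - f1 * d3 - e1 * h1) - f1 * (f3 * b2 - f2 * d3 - e2 * h1)
     - f3 * (f2 * b1 - f1 * b2 - v * h1)); last by ring.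
  by apply: idealB => //; [apply: idealB => //|]; apply: idealM.
(* With [w v = q f1 + p f2], the corrected coefficients [w b1 - p h1] and [w a1 + p h2] are locally
   multiples of [f1], which can then be cancelled from the expression of [f1 u]. *)
have /regf2 [w1 [mw1 /ideal_add_seq1P [y W1]]] :
    loc_contr (ideal_add_seq I [:: f1]) m (f2 * (w * b1 - p * h1)).
  exists 1; split=> //; apply/ideal_add_seq1P; exists (w * b2 + q * h1).
  rewrite (_ : _ - _ = w * (f2 * b1 - f1 * b2 - v * h1) + h1 * (w * v - q * f1 - p * f2));
    last by ring.
  by apply: idealD => //; apply: idealM.
have /regf2 [w2 [mw2 /ideal_add_seq1P [y' W2]]] :
    loc_contr (ideal_add_seq I [:: f1]) m (f2 * (w * a1 + p * h2)).
  exists 1; split=> //; apply/ideal_add_seq1P; exists (w * a2 - q * h2).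
  rewrite (_ : _ - _ = w * (f2 * a1 - f1 * a2 + v * h2) - h2 * (w * v - q * f1 - p * f2));
    last by ring.
  by apply: idealB => //; apply: idealM.
have /regf1 [w3 [mw3 W3]] : loc_contr (ideal_add_seq I [::]) m
    (f1 * (w1 * w2 * w * u - (w1 * y') * h1 - (w2 * y) * h2)).
  exists 1; split=> //; apply/(ideal_add_seq_nilP _ iI).
  rewrite (_ : _ * _ = w1 * w2 * w * (f1 * u - a1 * h1 - b1 * h2)
    + w1 * h1 * (w2 * (w * a1 + p * h2) - y' * f1)
    + w2 * h2 * (w1 * (w * b1 - p * h1) - y * f1)); last by ring.
  by apply: idealD => //; [apply: idealD => //|]; apply: idealM.
exists (w3 * (w1 * w2 * w)), (w3 * (w1 * y')), (w3 * (w2 * y)).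
split; first by do !apply: mM.
move/(ideal_add_seq_nilP _ iI): W3; congr I; ring.
Qed.
End Depth.

(** * Algebraicity of residue fields (Zariski) *)

Section Nullstellensatz.

(* The localization of [A / M] at the powers of some [h] is a field. *)
Definition generic_field (A : comNzRingType) (M : A -> Prop) :=
  exists h, ~ M h /\ forall b, ~ M b -> exists c e, M (b * c - h ^+ e).

Lemma ex_min_size (A : comNzRingType) (Q : {poly A} -> Prop) p : Q p ->
  exists q, Q q /\ forall r, Q r -> (size q <= size r)%N.
Proof.
have [n] := ubnP (size p); elim: n p => // n IHn p; rewrite ltnS => pn Qp.
have [[q [Qq qp]]|no] := boolp.EM (exists q, Q q /\ (size q < size p)%N).
  by apply: IHn Qq; apply: leq_trans qp pn.
exists p; split=> // r Qr; rewrite leqNgt; apply/negP => rp.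
by apply: no; exists r.
Qed.

Section Descent.
Variables (A : idomainType) (M : {poly A} -> Prop).
Hypothesis pM : prime_ideal M.
Let iM : is_ideal M. Proof. by case: pM. Qed.
Let M1 : ~ M 1. Proof. by case: pM. Qed.
Let MM (p q : {poly A}) : M (p * q) -> M p \/ M q. Proof. by case: pM => _ _; apply. Qed.
Let N a := M a%:P.

Let iN : is_ideal N.
Proof.
split; rewrite /N ?polyC0; first exact: ideal0.
  by move=> a b; rewrite polyCD; apply: idealD.
by move=> r a; rewrite polyCM; apply: idealM.
Qed.
Let NM a b : N (a * b) -> N a \/ N b. Proof. by rewrite /N polyCM => /MM. Qed.
Let N0 a : ~ N a -> a != 0.
Proof. by move=> Na; apply/eqP => a0; apply: Na; rewrite a0; apply: ideal0. Qed.
Let NX a n : ~ N a -> ~ N (a ^+ n).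
Proof. by move=> Na; rewrite /N polyC_exp => /(prime_idealX pM). Qed.

Lemma truncE (p : {poly A}) n : (size p <= n.+1)%N ->
  p = \poly_(i < n) p`_i + (p`_n)%:P * 'X^n.
Proof.
move=> sp; apply/polyP => i; rewrite coefD coef_poly coefCM coefXn.
case: (ltngtP i n) => [_|ni|->]; rewrite ?mulr0 ?mulr1 ?addr0 ?add0r //.
by rewrite nth_default // (leq_trans sp).
Qed.

(** This stands in for reduction to [A/N]: a leading coefficient outside [N] makes degrees those of
    the reduced polynomials. *)
Lemma truncate (p : {poly A}) : ~ M p -> exists p' : {poly A},
  [/\ M (p - p'), ~ N (lead_coef p') & (size p' <= size p)%N].
Proof.
have [n] := ubnP (size p); elim: n p => // n IHn p; rewrite ltnS => pn Mp.
have [Nl|Nl] := boolp.EM (N (lead_coef p)); last first.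
  by exists p; rewrite subrr; split=> //; apply: ideal0.
have [sp0|sp] := posnP (size p).
  by case: Mp; rewrite (eqP (_ : p == 0)) -?size_poly_eq0 ?sp0 //; apply: ideal0.
have E := @truncE p (size p).-1; rewrite prednK // leqnn in E.
set q := \poly_(i < _) _ in E.
have Mpq : M (p - q).
  rewrite {1}E // addrAC subrr add0r; apply: idealMr => //.
have sq : (size q < size p)%N by rewrite -(prednK sp) ltnS size_poly.
have [||p' [Mp' Np' sp']] := IHn q; first by apply: leq_trans pn.
  by move=> Mq; apply: Mp; rewrite -(subrK q p); apply: idealD.
exists p'; split=> //; last by apply: leq_trans sp' (ltnW sq).
by rewrite (_ : p - p' = (p - q) + (q - p')); [apply: idealD|ring].
Qed.

(** Otherwise the variable is transcendental over [A/N]. Then [b = 1 + X h'] is non-constant and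
    prime to [h'], yet divides a power of [h'] modulo [M]; so it is a unit, against its degree. *)
Lemma generic_field_algebraic : generic_field M ->
  exists P : {poly A}, M P /\ ~ N (lead_coef P).
Proof.
move=> [h [Mh inv]]; apply: boolp.contrapT => no.
have MN (P : {poly A}) : M P -> N (lead_coef P).
  by move=> MP; apply: boolp.contrapT => NP; apply: no; exists P.
have [h' [Mhh' Nh' _]] := truncate Mh.
pose b : {poly A} := 1 + 'X * h'.
have h'0 : h' != 0 by rewrite -lead_coef_eq0; apply: N0.
have sX : (1 < size ('X * h')%R)%N by rewrite mulrC size_mulX // ltnS size_poly_gt0.
have sb : (1 < size b)%N by rewrite /b addrC size_polyDl ?size_poly1.
have lb : lead_coef b = lead_coef h'.
  by rewrite /b addrC lead_coefDl ?size_poly1 // mulrC lead_coefMX.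
have Mb : ~ M b by move/MN; rewrite lb.
have [c [e Mc]] := inv _ Mb.
have Mhe : M (h ^+ e - h' ^+ e) by rewrite subrXX; apply: idealMr.
(* Modulo [b] the product [X h'] is [-1], so multiplying [b c = h ^+ e] by a power of [X] produces
   the inverse [c'] of [b]. *)
have [w Ew] : exists w : {poly A}, ('X * h') ^+ e = (-1) ^+ e + b * w.
  elim: (e) => [|i [w Ew]]; first by exists 0; ring.
  exists ('X * h' * w + (-1) ^+ i); rewrite exprS Ew /b exprS; ring.
have Me : (-1) ^+ e * (-1) ^+ e = 1 :> {poly A}.
  by rewrite -exprD addnn -mul2n exprM sqrrN expr1n expr1n.
pose c' : {poly A} := (-1) ^+ e * (c * 'X^e - w).
have Mbc : M (b * c' - 1).
  rewrite (_ : _ - 1 = (-1) ^+ e * 'X^e * ((b * c - h ^+ e) + (h ^+ e - h' ^+ e))).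
    by apply: idealM => //; apply: idealD.
  transitivity ((-1) ^+ e * (b * c * 'X^e - ((-1) ^+ e + b * w))).
    by rewrite -[X in _ - X]Me /c'; ring.
  by rewrite -Ew exprMn; ring.
have Mc' : ~ M c'.
  move=> Mc'; apply: M1; rewrite (_ : 1 = b * c' - (b * c' - 1)); last by ring.
  by apply: idealB => //; apply: idealM.
have [c2 [Mc2 Nc2 _]] := truncate Mc'.
have c20 : c2 != 0 by rewrite -lead_coef_eq0; apply: N0.
have : M (b * c2 - 1).
  rewrite (_ : _ - _ = (b * c' - 1) - b * (c' - c2)); last by ring.
  by apply: idealB => //; apply: idealM.
have sbc : (1 < size (b * c2)%R)%N.
  rewrite size_mul // -?size_poly_gt0 ?(ltnW sb) //.
  move: sb c20; rewrite -size_poly_gt0; case: (size b) => [|[|s]] // _.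
  by case: (size c2) => // s' _; rewrite addSn addnS.
move/MN; rewrite lead_coefDl ?size_polyN ?size_poly1 // lead_coefM lb.
by move/NM => [].
Qed.

(** Here [P] plays the minimal polynomial of the variable over the fractions of [A/N]. Inverting its
    leading coefficient [a] and a constant [b0] that is a multiple of [h] modulo [M] clears all
    denominators. *)
Lemma generic_field_contract : generic_field M -> generic_field N.
Proof.
move=> FM; have [P0 QP0] := generic_field_algebraic FM.
have [P [[MP NP] Pmin]] := @ex_min_size A (fun P => M P /\ ~ N (lead_coef P)) _ QP0.
case: FM => h [Mh inv]; set a := lead_coef P in NP.
have P0' : P != 0 by rewrite -lead_coef_eq0; apply: N0.
have lcM (r : {poly A}) : M r -> (size r < size P)%N -> N (lead_coef r).
  move=> Mr rP; apply: boolp.contrapT => Nr.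
  by have := Pmin r (conj Mr Nr); rewrite leqNgt rP.
have sP : (1 < size P)%N.
  rewrite ltnNge; apply/negP => sP; apply: NP.
  by rewrite /N /a [X in lead_coef X](size1_polyC sP) lead_coefC -size1_polyC.
have coef0M (r : {poly A}) : M r -> (size r < size P)%N -> N r`_0.
  have [n] := ubnP (size r); elim: n r => // n IHn r; rewrite ltnS => rn Mr rP.
  have [sr0|sr] := posnP (size r).
    by rewrite nth_default ?sr0 //; apply: ideal0.
  have E := @truncE r (size r).-1; rewrite prednK // leqnn in E.
  have {}E := E isT; set q := \poly_(i < _) _ in E.
  have Mq : M q.
    rewrite (_ : q = r - (r`_(size r).-1)%:P * 'X^((size r).-1)); last by rewrite [X in X - _]E addrK.
    by apply: idealB => //; apply: idealMr => //; apply: lcM.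
  have sq : (size q < size r)%N by rewrite -(prednK sr) ltnS size_poly.
  have := IHn q (leq_trans sq rn) Mq (ltn_trans sq rP).
  rewrite coef_poly; case: ltnP => // + _.
  rewrite leqn0 => /eqP sr1; have := lcM _ Mr rP.
  by rewrite lead_coefE sr1.
have div (Q p : {poly A}) : Q != 0 -> exists j (q r : {poly A}),
    (lead_coef Q ^+ j) *: p = q * Q + r /\ (size r < size Q)%N.
  move=> Q0; exists (scalp p Q), (p %/ Q), (p %% Q).
  by rewrite Pdiv.Idomain.divp_eq ltn_modp.
(* Candidates for a Bezout relation between [h] and [P]; the shortest one turns out to be
   constant. *)
pose G (g : {poly A}) := [/\ ~ N (lead_coef g), (size g < size P)%N & exists c, M (g - h * c)].
have sub_trunc (r c : {poly A}) : M (r - h * c) -> ~ M r -> (size r < size P)%N ->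
    exists2 g : {poly A}, G g & (size g <= size r)%N.
  move=> Mrc Mr rP; have [g [Mg Ng sg]] := truncate Mr.
  exists g => //; split=> //; first exact: leq_ltn_trans rP.
  exists c; rewrite (_ : _ - _ = (r - h * c) - (r - g)); last by ring.
  exact: idealB.
have [g1 Gg1] : exists g, G g.
  have [j [q [r [E rP]]]] := div P h P0'.
  have [||g Gg _] := sub_trunc r (a ^+ j)%:P _ _ rP; last by exists g.
  - rewrite mulrC mul_polyC E opprD addrCA subrr addr0 -mulNr.
    exact: idealM.
  - move=> Mr; have : M ((a ^+ j)%:P * h).
      by rewrite mul_polyC E; apply: idealD => //; apply: idealM.
    by move/MM => [/NX|].
have [g [[Ng gP [c0 Mc0]] gmin]] := ex_min_size Gg1.
have g0 : g != 0 by rewrite -lead_coef_eq0; apply: N0.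
(* Dividing [P] by a non-constant [g] leaves a remainder in [M] by minimality of [g]. The prime [M]
   then contains the quotient [q], shorter than [P] and with leading coefficient outside [N]. *)
have sg : (size g <= 1)%N.
  rewrite leqNgt; apply/negP => sg.
  have [j [q [r [E rg]]]] := div g P g0.
  have NgX : ~ N (lead_coef g ^+ j) by apply: NX.
  have [Mr|Mr] := boolp.EM (M r); last first.
    have [|g' /gmin] := sub_trunc r (- q * c0) _ Mr (ltn_trans rg gP); last first.
      by move=> gg' g'r; have := leq_trans gg' g'r; rewrite leqNgt rg.
    rewrite (_ : _ - _ = (lead_coef g ^+ j) *: P - q * (g - h * c0)); last by rewrite E; ring.
    by apply: idealB => //; [rewrite -mul_polyC|]; apply: idealM.
  have Mq : M q.
    have : M (q * g).
      rewrite (_ : q * g = (lead_coef g ^+ j)%:P * P - r); last by rewrite mul_polyC E addrK.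
      by apply: idealB => //; apply: idealM.
    case/MM => // Mg; case: Ng; apply: lcM => //.
  have qg : q * g = (lead_coef g ^+ j) *: P - r by rewrite E addrK.
  have sr : (size (- r)%R < size ((lead_coef g ^+ j) *: P)%R)%N.
    by rewrite size_polyN size_scale ?N0 // (ltn_trans rg gP).
  have sqg : size (q * g) = size P by rewrite qg size_polyDl // size_scale ?N0.
  have lqg : lead_coef q * lead_coef g = lead_coef g ^+ j * a.
    by rewrite -lead_coefM qg lead_coefDl // lead_coefZ.
  have q0 : q != 0.
    by apply/eqP => q0; move: P0'; rewrite -size_poly_eq0 -sqg q0 mul0r size_poly0.
  have : (size q < size P)%N.
    rewrite -sqg size_mul //; case: (size g) sg => [|[|s]] // _.
    by rewrite !addnS /= ltnS leq_addr.
  move/(lcM _ Mq) => Nq; have : N (lead_coef g ^+ j * a).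
    by rewrite -lqg; apply: idealMr.
  by move/NM => [].
have Eg := size1_polyC sg; set b0 := g`_0 in Eg.
have Nb0 : ~ N b0 by move=> Nb0; apply: Ng; rewrite Eg lead_coefC.
exists (a * b0); split; first by move/NM => [].
move=> b Nb; have [c [e Mc]] := inv b%:P Nb.
have Mc1 : M (b%:P * (c * c0 ^+ e) - (b0 ^+ e)%:P).
  have Mh' : M (g ^+ e - (h * c0) ^+ e) by rewrite subrXX; apply: idealMr.
  rewrite (_ : _ - _ = c0 ^+ e * (b%:P * c - h ^+ e) - (g ^+ e - (h * c0) ^+ e)).
    by apply: idealB => //; apply: idealM.
  by rewrite polyC_exp -Eg exprMn; ring.
have [j [q [r [E rP]]]] := div P (c * c0 ^+ e) P0'.
have Mr : M (b%:P * r - (a ^+ j * b0 ^+ e)%:P).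
  rewrite (_ : _ - _ = (a ^+ j)%:P * (b%:P * (c * c0 ^+ e) - (b0 ^+ e)%:P) - b%:P * q * P).
    by apply: idealB => //; apply: idealM.
  have -> : r = (a ^+ j)%:P * (c * c0 ^+ e) - q * P by rewrite mul_polyC E; ring.
  by rewrite polyCM; ring.
(* Elements of [M] shorter than [P] have their constant coefficient in [N], so the relation descends
   to [A]. *)
have Nr : N (b * r`_0 - a ^+ j * b0 ^+ e).
  have := coef0M _ Mr; rewrite coefB coefCM coefC /=; apply.
  rewrite (leq_ltn_trans (size_polyD _ _)) // size_polyN gtn_max.
  rewrite (leq_ltn_trans (size_polyC_leq1 _)) // andbT mul_polyC.
  exact: leq_ltn_trans (size_scale_leq _ _) rP.
exists (r`_0 * b0 ^+ j * a ^+ e), (j + e)%N.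
rewrite (_ : _ - _ = (b0 ^+ j * a ^+ e) * (b * r`_0 - a ^+ j * b0 ^+ e)).
  exact: idealM.
by rewrite exprMn !exprD; ring.
Qed.
End Descent.

Variables (T : comNzRingType) (m : T -> Prop).
Hypothesis mm : maximal_ideal m.

Lemma prime_ideal_preim (A : comNzRingType) (f : {rmorphism A -> T}) P :
  prime_ideal P -> prime_ideal (fun a => P (f a)).
Proof.
move=> [iP P1 PM]; split; [split| |].
- by rewrite rmorph0; apply: ideal0.
- by move=> a b; rewrite rmorphD; apply: idealD.
- by move=> r a; rewrite rmorphM; apply: idealM.
- by rewrite rmorph1.
- by move=> a b; rewrite rmorphM; apply: PM.
Qed.

(** Induction on the generators: one of them becomes the variable of [{poly A}], and the result is
    contracted to [A]. With none left, [f] is onto and [h = 1] works because [T/m] is a field. *)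
Lemma generic_field_preim (xs : seq T) (A : idomainType) (f : {rmorphism A -> T}) :
  (forall S : T -> Prop, (forall a, S (f a)) -> (forall x, x \in xs -> S x) ->
     (forall a b, S a -> S b -> S (a + b)) -> (forall a b, S a -> S b -> S (a * b)) ->
     forall t, S t) ->
  generic_field (fun a => m (f a)).
Proof.
have pm := maximal_ideal_prime mm; have im := prime_ideal_ideal pm.
elim: xs A f => [|x xs IHxs] A f gen.
  have sur t : exists a, f a = t.
    apply: (gen (fun t => exists a, f a = t)) => // [a|_ _ [a <-] [b <-]|_ _ [a <-] [b <-]].
    - by exists a.
    - by exists (a + b); rewrite rmorphD.
    - by exists (a * b); rewrite rmorphM.
  exists 1; rewrite rmorph1; split; first by case: pm.
  move=> b mb; have [t mt] := maximal_ideal_inv mm mb; have [c Ec] := sur t.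
  by exists c, 0%N; rewrite expr0 rmorphB rmorphM rmorph1 Ec.
have cf : commr_rmorph f x by move=> a; apply: mulrC.
pose F : {rmorphism {poly A} -> T} := horner_morph cf.
have FC a : F a%:P = f a by apply: horner_morphC.
have FX : F 'X = x by apply: horner_morphX.
have : generic_field (fun p => m (F p)).
  apply: IHxs => S SF Sxs SD SM; apply: gen => //.
    by move=> a; rewrite -FC.
  by move=> y; rewrite inE => /orP [/eqP ->|]; [rewrite -FX|apply: Sxs].
move/(generic_field_contract (prime_ideal_preim F pm)) => [h [Nh inv]].
exists h; rewrite -FC; split=> // b; rewrite -FC => /inv [c [e H]].
by exists c, e; rewrite -FC.
Qed.

(** Zariski's lemma for one element: some localization of the image of [k[X]] in [T/m] is a field,
    which rules out a zero kernel. *)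
Lemma maximal_ideal_algebraic (k : fieldType) (f : {rmorphism k -> T}) (xs : seq T) x :
  (forall S : T -> Prop, (forall a, S (f a)) -> (forall y, y \in xs -> S y) ->
     (forall a b, S a -> S b -> S (a + b)) -> (forall a b, S a -> S b -> S (a * b)) ->
     forall t, S t) ->
  exists p : {poly k}, p \is monic /\ m (map_poly f p).[x].
Proof.
have pm := maximal_ideal_prime mm; have im := prime_ideal_ideal pm.
move=> gen; have cf : commr_rmorph f x by move=> a; apply: mulrC.
pose F : {rmorphism {poly k} -> T} := horner_morph cf.
have : generic_field (fun p => m (F p)).
  apply: (@generic_field_preim xs) => S SF Sxs SD SM; apply: gen => // a.
  by have := SF a%:P; rewrite /F /= horner_morphC.
move/(generic_field_algebraic (prime_ideal_preim F pm)) => [P [mP NP]].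
have P0 : lead_coef P != 0.
  by apply: contra_notN NP => /eqP ->; rewrite polyC0 rmorph0; apply: ideal0.
exists ((lead_coef P)^-1 *: P); split.
  by rewrite monicE lead_coefZ mulVf.
rewrite map_polyZ hornerZ; exact: idealM.
Qed.
End Nullstellensatz.

(** * Krull dimension of finitely generated algebras *)

Section KrullDimension.

Lemma msizeM_leS (R : comNzRingType) n (p q : {mpoly R[n]}) a b :
  (msize p <= a.+1)%N -> (msize q <= b.+1)%N -> (msize (p * q)%R <= (a + b).+1)%N.
Proof.
move=> pa qb; rewrite msizeE big_seq; elim/big_ind: _ => // [x y xa yb|m].
  by rewrite geq_max xa.
move/msuppM_le/allpairsP => [[m1 m2] /= [m1p m2q ->]]; rewrite ltnS mdegD leq_add //.
  by rewrite -ltnS; apply: leq_trans pa; apply: msize_mdeg_lt.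
by rewrite -ltnS; apply: leq_trans qb; apply: msize_mdeg_lt.
Qed.

Lemma msizeX_leS (R : comNzRingType) n (p : {mpoly R[n]}) a e :
  (msize p <= a.+1)%N -> (msize (p ^+ e)%R <= (a * e).+1)%N.
Proof.
move=> pa; elim: e => [|e IHe]; first by rewrite expr0 msize1.
by rewrite exprS mulnS; apply: msizeM_leS.
Qed.

(** Extended by 0 to all naturals, so that products can be taken over ranges [i <= j < n]. *)
Definition expo n D (e : {ffun 'I_n -> 'I_D}) (j : nat) : nat :=
  if insub j is Some i then e i else 0%N.

Lemma expo_ord n D (e : {ffun 'I_n -> 'I_D}) (i : 'I_n) : expo e i = e i.
Proof. by rewrite /expo valK. Qed.

Lemma expo_inj n D (e e' : {ffun 'I_n -> 'I_D}) :
  (forall j, (j < n)%N -> expo e j = expo e' j) -> e = e'.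
Proof.
move=> ee; apply/ffunP => i; apply/val_inj.
by have := ee i (ltn_ord i); rewrite !expo_ord.
Qed.

(* There are [D ^ n.+1] monomials in [p 0, ..., p n] with all exponents below
   [D], and their values lie in a space of dimension [O(D ^ n)]. *)
Lemma algebraic_dependence (k : fieldType) n (p : nat -> {mpoly k[n]}) :
  exists D (c : {ffun 'I_n.+1 -> 'I_D} -> k), (exists e, c e != 0) /\
    \sum_e c e *: \prod_(j < n.+1) p j ^+ expo e j = 0.
Proof.
pose d := (\max_(j < n.+1) msize (p j))%N.
have pd (j : 'I_n.+1) : (msize (p j) <= d.+1)%N.
  by apply: leqW; apply: (leq_bigmax j).
(* The values have degree below [B], hence at most [B ^ n] coefficients to kill, and [B <= K D]. The
   choice [D = K ^ n + 1] gives [(K D) ^ n < D ^ n.+1]. *)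
pose K := (n.+1 * d).+1; pose D := (K ^ n).+1; pose B := (n.+1 * d * D).+1.
have BK : (B <= K * D)%N by exact: (@leq_add 1 _ D (n.+1 * d * D) isT (leqnn _)).
pose E := {ffun 'I_n.+1 -> 'I_D}; pose E' := {ffun 'I_n -> 'I_B}.
have cE : (#|{: E'}| < #|{: E}|)%N.
  rewrite !card_ffun !card_ord; apply: leq_ltn_trans (_ : (K * D) ^ n < _)%N.
    by case: (n) BK => [//|n0 BK]; rewrite leq_exp2r.
  by rewrite expnMn expnS ltn_pmul2r ?expn_gt0.
pose val_e (e : E) := \prod_(j < n.+1) p j ^+ expo e j.
have szv e : (msize (val_e e) <= (n.+1 * d * D).+1)%N.
  rewrite (_ : (n.+1 * d * D)%N = (\sum_(j < n.+1) d * D)%N); last first.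
    by rewrite sum_nat_const card_ord mulnA.
  rewrite /val_e; elim/big_rec2: _ => [|i y x _ xy]; first by rewrite msize1.
  apply: msizeM_leS xy; apply: leq_trans (msizeX_leS _ (pd i)) _.
  by rewrite ltnS leq_mul2l expo_ord ltnW ?orbT.
pose mon (e : E') := [multinom (e i : nat) | i < n].
pose M : 'M[k]_(#|{: E}|, #|{: E'}|) :=
  \matrix_(i, j) (val_e (enum_val i))@_(mon (enum_val j)).
have kM : kermx M != 0.
  rewrite -mxrank_eq0 mxrank_ker subn_eq0 -ltnNge.
  by apply: leq_ltn_trans cE; apply: rank_leq_col.
have /rowV0Pn [v /sub_kermxP vM v0] := kM.
exists D, (fun e => v 0 (enum_rank e)); split.
  have [j vj] : exists j, v 0 j != 0.
    apply/existsP; apply: contraR v0; rewrite negb_exists => /forallP v0.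
    by apply/eqP/rowP => j; rewrite mxE; apply/eqP; have := v0 j; rewrite negbK.
  by exists (enum_val j); rewrite enum_valK.
apply/mpolyP => m; rewrite mcoeff0 linear_sum /=.
have [mB|] := boolP [forall i, m i < B]%N; last first.
  rewrite negb_forall => /existsP [i]; rewrite -leqNgt => mB.
  apply: big1 => e _; rewrite mcoeffZ -/(val_e e) memN_msupp_eq0 ?mulr0 //.
  apply: msize_mdeg_ge; apply: leq_trans (szv e) _; apply: leq_trans mB _.
  by rewrite mdegE (bigD1 i) //= leq_addr.
pose e' : E' := [ffun i => Ordinal (forallP mB i)].
have -> : m = mon e' by apply/mnmP => i; rewrite mnmE ffunE.
have := congr1 (fun w : 'rV_ _ => w 0 (enum_rank e')) vM.
rewrite !mxE => E0; apply: etrans E0.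
rewrite (reindex (fun i : 'I_#|{: E}| => enum_val i)) /=; last by exists enum_rank => e _; rewrite (enum_valK, enum_rankK).
by apply: eq_bigr => i _; rewrite mcoeffZ mxE enum_valK enum_rankK.
Qed.

(* At each step keep the terms of minimal exponent in [b i] and divide by that
   power of [b i]: the other terms lie in [P i.+1]. *)
Lemma chain_independent (T : comNzRingType) (P : nat -> T -> Prop) (b : nat -> T) n D
    (c : {ffun 'I_n -> 'I_D} -> T) :
  (forall i, (i <= n)%N -> prime_ideal (P i)) ->
  (forall i, (i < n)%N -> ideal_sub (P i) (P i.+1)) ->
  (forall i, (i < n)%N -> P i.+1 (b i) /\ ~ P i (b i)) ->
  P 0%N (\sum_e c e * \prod_(j < n) b j ^+ expo e j) ->
  (exists e, c e != 0) -> exists e, c e != 0 /\ P n (c e).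
Proof.
move=> prP sP bP P0 ex0.
(* The terms kept in [A] share their exponents at all indices below [i]; at [i = n] a single one
   remains, reduced to its coefficient. *)
suff H i : (i <= n)%N -> exists A : {set {ffun 'I_n -> 'I_D}},
    [/\ A != set0, forall e, e \in A -> c e != 0,
        forall e e' j, e \in A -> e' \in A -> (j < i)%N -> expo e j = expo e' j &
        P i (\sum_(e in A) c e * \prod_(i <= j < n) b j ^+ expo e j)].
  have [A [/set0Pn [e eA] cA Aeq]] := H n (leqnn n).
  rewrite (bigD1 e) //= big_geq // mulr1 big1 ?addr0 => [|e' /andP [e'A /eqP []]].
    by exists e; split=> //; apply: cA.
  by apply: expo_inj => j jn; apply: Aeq.
elim: i => [|i IHi] lt.
  exists [set e | c e != 0]; split=> //.
  - by case: ex0 => e ce; apply/set0Pn; exists e; rewrite inE.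
  - by move=> e; rewrite inE.
  - move: P0; congr (P 0%N _); rewrite [LHS](bigID (fun e => c e != 0)) /=.
    rewrite [X in _ + X]big1 ?addr0 => [|e]; last by rewrite negbK => /eqP ->; rewrite mul0r.
    by apply: eq_big => [e|e _]; rewrite ?inE // big_mkord.
have [A [/set0Pn [e0 e0A] cA Aeq PA]] := IHi (ltnW lt).
have [mu [e1 [e1A Emu mule]]] : exists mu e1, [/\ e1 \in A, expo e1 i = mu &
    forall e, e \in A -> (mu <= expo e i)%N].
  case: (arg_minnP (fun e : {ffun 'I_n -> 'I_D} => expo e i) e0A) => e1 e1A H.
  by exists (expo e1 i), e1.
exists [set e in A | expo e i == mu]; split.
- by apply/set0Pn; exists e1; rewrite inE e1A Emu eqxx.
- by move=> e; rewrite inE => /andP [/cA].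
- move=> e e' j; rewrite !inE => /andP [eA /eqP ee] /andP [e'A /eqP ee'].
  by rewrite ltnS leq_eqVlt => /orP [/eqP ->|]; [rewrite ee|apply: Aeq].
have [iPi Pi1 PiM] := prP i (ltnW lt); have [iPS _ _] := prP i.+1 lt.
have [Pb Pnb] := bP i lt.
pose r := \sum_(e in A | expo e i != mu)
  c e * (b i ^+ (expo e i - mu).-1 * \prod_(i.+1 <= j < n) b j ^+ expo e j).
set s := \sum_(e in _) _.
have : P i (b i ^+ mu * (s + b i * r)).
  move: PA; congr (P i _); rewrite (bigID (fun e => expo e i == mu)) /= mulrDr.
  congr (_ + _).
    rewrite /s mulr_sumr; apply: eq_big => [e|e /andP [_ /eqP Ee]]; first by rewrite inE.
    by rewrite big_ltn // Ee mulrCA.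
  rewrite /r !mulr_sumr; apply: eq_bigr => e /andP [eA ne].
  have lte : (mu < expo e i)%N by rewrite ltn_neqAle eq_sym ne mule.
  have [d Ed] : exists d, expo e i = (mu + d.+1)%N.
    by exists (expo e i - mu.+1)%N; rewrite addnS -addSn subnKC.
  rewrite big_ltn // Ed addKn exprD exprS /=.
  by move: (b i ^+ mu) (b i ^+ d) (\prod_(i.+1 <= j < n) _) => x y w; ring.
move/PiM => [/(prime_idealX (prP i (ltnW lt)))//|/(sP i lt) Ps].
rewrite (_ : s = (s + b i * r) - r * b i); last by ring.
by apply: idealB => //; apply: idealM.
Qed.

(** Choose [b i] in [P i.+1] outside [P i]. Modulo [P 0] these [n.+1] elements are polynomials in
    [n] generators, so they satisfy a relation over [k], and the chain forces a non-zero constant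
    into [P n.+1]. Only the bottom prime matters, so the generators may depend on it. *)
Lemma dim_ge_le (k : fieldType) (T : comNzRingType) (f : {rmorphism k -> T}) n
    (I m : T -> Prop) N :
  (forall Q, prime_ideal Q -> ideal_sub I Q -> exists y : 'I_n -> T,
      forall t, exists p : {mpoly k[n]}, Q (t - mmap f y p)) ->
  dim_ge I m N -> (N <= n)%N.
Proof.
move=> gen [P [prP ltP IP _]]; rewrite leqNgt; apply/negP => nN.
have {gen}[y gen] := gen _ (prP 0%N isT) IP.
have sP i : (i <= N)%N -> ideal_sub (P 0%N) (P i).
  elim: i => [_ x //|i IHi] iN x /(IHi (ltnW iN)).
  by case: (ltP i iN) => H _; apply: H.
have ex i : exists p : {mpoly k[n]}, (i < N)%N ->
    P i.+1 (mmap f y p) /\ ~ P i (mmap f y p).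
  have [iN|iN] := ltnP i N; last by exists 0 => Ni; case: (leq_gtF iN); rewrite Ni.
  have [a [Pa Pna]] : exists a, P i.+1 a /\ ~ P i a.
    apply: boolp.contrapT => no; case: (ltP i iN) => _; apply => a Pa.
    by apply: boolp.contrapT => Pna; apply: no; exists a.
  have [p Pp] := gen a; exists p => _.
  have Pai : P i (a - mmap f y p) by apply: sP Pp; apply: ltnW.
  have PaS : P i.+1 (a - mmap f y p) by apply: sP Pp.
  split.
    rewrite (_ : mmap f y p = a - (a - mmap f y p)); last by rewrite opprB addrCA subrr addr0.
    by apply: idealB => //; apply/prime_ideal_ideal/prP.
  move=> Pp'; apply: Pna; rewrite -(subrK (mmap f y p) a).
  by apply: idealD => //; apply/prime_ideal_ideal/prP/ltnW.
have [p pP] := boolp.choice ex.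
have [D [c [c0 Ec]]] := algebraic_dependence p.
have [|||||e [ce Pe]] := @chain_independent T P (fun i => mmap f y (p i)) n.+1 D (fun e => f (c e)).
- by move=> i iN; apply: prP; apply: leq_trans iN nN.
- by move=> i iN; case: (ltP i (leq_trans iN nN)).
- by move=> i iN; apply: pP; apply: leq_trans iN nN.
- have : P 0%N (mmap f y 0) by rewrite rmorph0; apply: (ideal0 (prime_ideal_ideal (prP 0%N isT))).
  rewrite -Ec rmorph_sum /=; congr (P 0%N _); apply: eq_bigr => e _.
  rewrite mmapZ rmorph_prod; congr (_ * _).
  by apply: eq_bigr => j _; rewrite rmorphXn.
- by case: c0 => e ce; exists e; rewrite fmorph_eq0.
case: (prP n.+1 nN) => iP P1 _; apply: P1.
rewrite (_ : 1 = f (c e)^-1 * f (c e)); first exact: idealM.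
by rewrite -rmorphM mulVf ?rmorph1 // -(fmorph_eq0 f).
Qed.
End KrullDimension.

(** * Regular elements and extended ideals *)

Section Regular.
Variable T : comNzRingType.
Implicit Types (I J : T -> Prop).

Definition reg I x := forall g, I (x * g) -> I g.
Definition addI I x := ideal_gen (fun h => I h \/ h = x).

Lemma addIP I x f : is_ideal I -> addI I x f <-> exists d, I (f - d * x).
Proof.
move=> iI; apply: iff_trans (ideal_genUP _ _ iI) _; split=> [[c [d [Ic ->]]]|[d Id]].
  by exists d; rewrite addrK.
by exists (f - d * x), d; rewrite subrK.
Qed.

Lemma addI_ideal I x : is_ideal (addI I x). Proof. exact: ideal_gen_ideal. Qed.

Lemma eq_reg I J x : (forall f, I f <-> J f) -> reg I x -> reg J x.
Proof. by move=> IJ rI g /IJ /rI /IJ. Qed.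

Lemma regM I x y : reg I x -> reg I y -> reg I (x * y).
Proof. by move=> rx ry g; rewrite -mulrA => /rx /ry. Qed.

(** The half of the permutation of a regular sequence that holds with no local or graded
    assumption. *)
Lemma reg_swap I x y : is_ideal I -> reg I x -> reg (addI I x) y -> reg (addI I y) x.
Proof.
move=> iI rx ry g /(addIP _ _ iI) [d Id].
have /ry /(addIP _ _ iI) [d' Id'] : addI I x (y * d).
  apply/addIP => //; exists g; rewrite (_ : _ - _ = - (x * g - d * y)); last by ring.
  exact: idealN.
apply/addIP => //; exists d'; apply: rx.
rewrite (_ : _ * _ = (x * g - d * y) + y * (d - d' * x)); last by ring.
by apply: idealD => //; apply: idealM.
Qed.
End Regular.

Section Extension.
Variable A : comNzRingType.
Implicit Types (I J : A -> Prop).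

(** This is the extended ideal [I A[X]], described by coefficients. *)
Definition ext I (f : {poly A}) := forall i, I f`_i.

Lemma ext_ideal I : is_ideal I -> is_ideal (ext I).
Proof.
move=> iI; split=> [i|a b Ia Ib i|r a Ia i].
- by rewrite coef0; apply: ideal0.
- by rewrite coefD; apply: idealD.
- by rewrite coefM; apply: ideal_sum => // j _; apply: idealM.
Qed.

Lemma extC I a : is_ideal I -> ext I a%:P <-> I a.
Proof.
move=> iI; split=> [/(_ 0%N)|Ia i]; first by rewrite coefC.
by rewrite coefC; case: eqP => // _; apply: ideal0.
Qed.

Lemma ext_min I (K : {poly A} -> Prop) : is_ideal K ->
  (forall a, I a -> K a%:P) -> ideal_sub (ext I) K.
Proof.
move=> iK IK f If; rewrite -[f]coefK poly_def; apply: ideal_sum => // i _.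
by rewrite -mul_polyC; apply: idealMr => //; apply: IK.
Qed.

Lemma ext_gen (G : A -> Prop) f :
  ideal_gen (fun h => exists2 g, G g & h = g%:P) f <-> ext (ideal_gen G) f.
Proof.
have iG := ideal_gen_ideal G; split; move: f.
  apply: ideal_gen_min => [|_ [g Gg ->]]; first exact: ext_ideal.
  by apply/extC => //; apply: mem_ideal_gen.
apply: ext_min => [|a]; first exact: ideal_gen_ideal.
apply: (@ideal_gen_min _ _ (fun a => ideal_gen _ a%:P)).
  have iK := ideal_gen_ideal (fun h => exists2 g, G g & h = g%:P).
  split=> [|x y|r x]; rewrite ?polyC0 ?polyCD ?polyCM; first exact: ideal0.
    exact: idealD.
  exact: idealM.
by move=> h Gh; apply: mem_ideal_gen; exists h.
Qed.

Lemma ext_addI I x f : is_ideal I -> addI (ext I) x%:P f <-> ext (addI I x) f.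
Proof.
move=> iI; split; move: f.
  apply: ideal_gen_min => [|h [Ih i| ->]]; first exact/ext_ideal/addI_ideal.
    by apply: mem_ideal_gen; left.
  by apply/extC; [apply: addI_ideal|apply: mem_ideal_gen; right].
apply: ext_min => [|a /(addIP _ _ iI) [d Id]]; first exact: addI_ideal.
apply/addIP; first exact: ext_ideal.
by exists d%:P; rewrite -polyCM -polyCB; apply/extC.
Qed.

Lemma eq_ideal_gen (T : comNzRingType) (G G' : T -> Prop) f :
  (forall h, G h <-> G' h) -> ideal_gen G f <-> ideal_gen G' f.
Proof.
by move=> GG; split; move: f; apply: ideal_genS => h /GG Gh; apply: mem_ideal_gen.
Qed.

Lemma eq_ideal_pow (T : comNzRingType) (I J : T -> Prop) n f :
  (forall h, I h <-> J h) -> ideal_pow I n f <-> ideal_pow J n f.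
Proof.
move=> IJ; elim: n f => [|n IHn] f //=.
by apply: eq_ideal_gen => h; split=> -[a [b [/IJ ? /IHn ? ->]]]; exists a, b.
Qed.

Lemma ideal_pow_ideal (T : comNzRingType) (I : T -> Prop) n : is_ideal (ideal_pow I n).
Proof. by case: n => [|n]; apply: ideal_gen_ideal. Qed.

Lemma ideal_pow0 (T : comNzRingType) (I : T -> Prop) f : ideal_pow I 0 f.
Proof. by apply/ideal_gen1P; exists f; rewrite mulr1. Qed.

Lemma ideal_pow1 (T : comNzRingType) (I : T -> Prop) f : is_ideal I ->
  ideal_pow I 1 f <-> I f.
Proof.
move=> iI; split; move: f; last first.
  move=> f If; apply: mem_ideal_gen; exists f, 1; rewrite mulr1; split=> //.
  exact: (ideal_pow0 I).
by apply: ideal_gen_min => // h [a [b [Ia _ ->]]]; apply: idealMr.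
Qed.

Lemma ext_prod I J f : is_ideal I -> is_ideal J ->
  ideal_prod (ext I) (ext J) f <-> ext (ideal_prod I J) f.
Proof.
move=> iI iJ; split; move: f.
  apply: ideal_gen_min => [|_ [a [b [Ia Jb ->]]] i]; first exact/ext_ideal/ideal_gen_ideal.
  rewrite coefM; apply: ideal_sum => [|j _]; first exact: ideal_gen_ideal.
  by apply: mem_ideal_gen; exists a`_j, b`_(i - j).
apply: ext_min => [|a]; first exact: ideal_gen_ideal.
have iK : is_ideal (ideal_prod (ext I) (ext J)) by apply: ideal_gen_ideal.
apply: (@ideal_gen_min _ _ (fun a => ideal_prod (ext I) (ext J) a%:P)).
  split=> [|x y|r x]; rewrite ?polyC0 ?polyCD ?polyCM; first exact: ideal0.
    exact: idealD.
  exact: idealM.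
move=> _ [b [c [Ib Jc ->]]]; apply: mem_ideal_gen; exists b%:P, c%:P.
by rewrite polyCM; split=> //; apply/extC.
Qed.

Lemma ext_pow I n f : is_ideal I -> ideal_pow (ext I) n f <-> ext (ideal_pow I n) f.
Proof.
move=> iI; elim: n f => [|n IHn] f.
  by split=> [_ i|_]; apply: ideal_pow0.
rewrite -[ideal_pow I n.+1]/(ideal_prod I (ideal_pow I n)).
apply: iff_trans (ext_prod _ iI (ideal_pow_ideal _ _)); apply: eq_ideal_gen => h.
by split=> -[a [b [? /IHn ? ->]]]; exists a, b.
Qed.

Lemma reg_extC I x : reg I x -> reg (ext I) x%:P.
Proof. by move=> rx g Ig i; apply: rx; rewrite -coefCM. Qed.

(** The coefficients of [g] enter [I] from the top down: the coefficient of degree [deg f + i] of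
    [f g] is that of degree [i] of [g], up to higher coefficients of [g]. *)
Lemma reg_ext_monic I f : is_ideal I -> f \is monic -> reg (ext I) f.
Proof.
move=> iI mf g Ifg; have f0 := monic_neq0 mf.
have sf : size f = (size f).-1.+1 by rewrite prednK // size_poly_gt0.
suff H n i : (size g - n <= i)%N -> I g`_i by move=> i; apply: (H (size g)); rewrite subnn.
elim: n i => [|n IHn] i; first by rewrite subn0 => gi; rewrite nth_default //; apply: ideal0.
move=> ni; have := Ifg ((size f).-1 + i)%N; rewrite coefM.
have lt : ((size f).-1 < ((size f).-1 + i).+1)%N by rewrite ltnS leq_addr.
rewrite (bigD1 (Ordinal lt)) //= addKn -lead_coefE (monicP mf) mul1r => H.
rewrite -[g`_i](addrK (\sum_(j < ((size f).-1 + i).+1 | j != Ordinal lt) f`_j * g`_((size f).-1 + i - j))).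
apply: idealB => //; apply: ideal_sum => // j; rewrite -val_eqE /= => jf.
have [fj|jf'] := ltnP (size f).-1 j.
  by rewrite [f`_j]nth_default ?mul0r; [apply: ideal0|exact: leq_trans (leqSpred _) fj].
have {}jf : (j < (size f).-1)%N by rewrite ltn_neqAle jf.
apply: idealM => //; apply: IHn; clear -ni jf; move: ni jf.
by move: (size g) (size f).-1 (nat_of_ord j) => a b c; lia.
Qed.

(** The same from the bottom up: [f] is invertible as a power series. *)
Lemma reg_ext_coef0 I (f : {poly A}) v : is_ideal I -> v * f`_0 = 1 -> reg (ext I) f.
Proof.
move=> iI f0 g Ifg i; have [n] := ubnP i; elim: n i => // n IHn i.
rewrite ltnS => iN; have := Ifg i; rewrite coefM big_ord_recl /= subn0 => H.
rewrite -[g`_i]mul1r -f0 -mulrA; apply: idealM => //.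
rewrite -[f`_0 * _](addrK (\sum_(j < i) f`_(bump 0 j) * g`_(i - bump 0 j))).
apply: idealB => //; apply: ideal_sum => // j _; apply: idealM => //; apply: IHn.
by rewrite /bump /=; have := ltn_ord j; lia.
Qed.
End Extension.

(** * Linear coordinates in the plane *)

Section Morphisms.

Lemma rmorph_poly_eq (A T : comNzRingType) (f g : {rmorphism {poly A} -> T}) :
  (forall a, f a%:P = g a%:P) -> f 'X = g 'X -> f =1 g.
Proof.
move=> fgC fgX; elim/poly_ind => [|p c IHp]; first by rewrite !rmorph0.
by rewrite !rmorphD !rmorphM IHp fgC fgX.
Qed.

Lemma rmorph_mpoly_eq (k T : comNzRingType) n (f g : {rmorphism {mpoly k[n]} -> T}) :
  (forall c, f c%:MP = g c%:MP) -> (forall i, f 'X_i = g 'X_i) -> f =1 g.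
Proof.
move=> fgC fgX; elim/mpolyind => [|c m p _ _ IHp]; first by rewrite !rmorph0.
rewrite !rmorphD -mul_mpolyC !rmorphM IHp fgC mpolyXE_id !rmorph_prod.
by congr (_ * _ + _); apply: eq_bigr => i _; rewrite !rmorphXn fgX.
Qed.

Definition adjoin (A T : comNzRingType) (f : {rmorphism A -> T}) (x : T) :
  {rmorphism {poly A} -> T} := horner_morph (fun a => mulrC x (f a)).

Lemma adjoinE (A T : comNzRingType) (f : {rmorphism A -> T}) x p :
  adjoin f x p = (map_poly f p).[x].
Proof. by []. Qed.
Lemma adjoinC (A T : comNzRingType) (f : {rmorphism A -> T}) x a : adjoin f x a%:P = f a.
Proof. exact: horner_morphC. Qed.
Lemma adjoinX (A T : comNzRingType) (f : {rmorphism A -> T}) x : adjoin f x 'X = x.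
Proof. exact: horner_morphX. Qed.

Lemma reg_iso (U T : comNzRingType) (f : {rmorphism U -> T}) (I : T -> Prop) u :
  (forall t, exists u, f u = t) -> reg (fun u => I (f u)) u -> reg I (f u).
Proof.
by move=> sur ru t; have [v <-] := sur t; rewrite -rmorphM => /ru.
Qed.

Lemma ideal_gen_iso (U T : comNzRingType) (f : {rmorphism U -> T}) (G : T -> Prop) u :
  bijective f -> ideal_gen G (f u) <-> ideal_gen (fun u => G (f u)) u.
Proof.
move=> [g fK gK]; split=> -[l [Gl E]].
  exists [seq (g p.1, g p.2) | p <- l]; split.
    by move=> p /mapP [q /Gl Gq ->]; rewrite gK.
  rewrite -[u]fK E big_map; apply: (can_inj fK); rewrite gK rmorph_sum /=.
  by apply: eq_bigr => p _; rewrite rmorphM !gK.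
exists [seq (f p.1, f p.2) | p <- l]; split.
  by move=> p /mapP [q /Gl Gq ->].
by rewrite E big_map rmorph_sum; apply: eq_bigr => p _; rewrite rmorphM.
Qed.

Lemma addI_iso (U T : comNzRingType) (f : {rmorphism U -> T}) (I : T -> Prop) x u :
  bijective f -> addI (fun u => I (f u)) x u <-> addI I (f x) (f u).
Proof.
move=> bf; apply: iff_sym; apply: iff_trans (ideal_gen_iso _ _ bf) _.
apply: eq_ideal_gen => h; split=> -[?|E]; [by left| |by left|by right; rewrite E].
by right; apply: (bij_inj bf).
Qed.

Lemma ideal_pow_iso (U T : comNzRingType) (f : {rmorphism U -> T}) (I : T -> Prop) n u :
  bijective f -> ideal_pow I n (f u) <-> ideal_pow (fun u => I (f u)) n u.
Proof.
move=> bf; elim: n u => [|n IHn] u; first by split=> _; apply: ideal_pow0.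
apply: iff_trans (ideal_gen_iso _ _ bf) _; apply: eq_ideal_gen => h.
have [g fK gK] := bf; split=> -[a [b [Ia Ib E]]].
  exists (g a), (g b); rewrite gK; split=> //; first by apply/IHn; rewrite gK.
  by apply: (can_inj fK); rewrite E rmorphM !gK.
by exists (f a), (f b); rewrite E rmorphM; split=> //; apply/IHn.
Qed.
End Morphisms.

(* A triple [(x, y, z)] stands for the linear form with these coefficients; three
   independent forms [a b c] give an isomorphism [coord] onto [k[x,y,z]]. *)
Section LinearForms.
Variable k : fieldType.
Implicit Types a b c : k * k * k.
Local Notation C := (@mpolyC 3 k).

Definition kC : {rmorphism k -> SS k} := C.

Definition lform a : SS k := kC a.1.1 * vS k 0 + kC a.1.2 * vS k 1 + kC a.2 * vS k 2.

Definition cross a b : k * k * k :=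
  (a.1.2 * b.2 - a.2 * b.1.2, a.2 * b.1.1 - a.1.1 * b.2, a.1.1 * b.1.2 - a.1.2 * b.1.1).
Definition dot a b : k := a.1.1 * b.1.1 + a.1.2 * b.1.2 + a.2 * b.2.

(** The vectors [cross b c], [cross c a], [cross a b] are the columns of the adjugate of the matrix
    with rows [a], [b], [c]; this lemma and the next are its products with that matrix on either
    side. *)
Lemma cramer (U : comNzRingType) (f : {rmorphism k -> U}) a b c (x y z : U) :
  let L v := f v.1.1 * x + f v.1.2 * y + f v.2 * z in
  let D := f (dot (cross a b) c) in
  [/\ f (cross b c).1.1 * L a + f (cross c a).1.1 * L b + f (cross a b).1.1 * L c = D * x,
      f (cross b c).1.2 * L a + f (cross c a).1.2 * L b + f (cross a b).1.2 * L c = D * y &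
      f (cross b c).2 * L a + f (cross c a).2 * L b + f (cross a b).2 * L c = D * z].
Proof.
case: a => [[a0 a1] a2]; case: b => [[b0 b1] b2]; case: c => [[c0 c1] c2].
rewrite /cross /dot /=; split; ring.
Qed.

Lemma cramer_inv (U : comNzRingType) (f : {rmorphism k -> U}) a b c (x y z : U) :
  let w g := f (g (cross b c)) * x + f (g (cross c a)) * y + f (g (cross a b)) * z in
  let L v := f v.1.1 * w (fun v => v.1.1) + f v.1.2 * w (fun v => v.1.2)
             + f v.2 * w (fun v => v.2) in
  let D := f (dot (cross a b) c) in
  [/\ L a = D * x, L b = D * y & L c = D * z].
Proof.
case: a => [[a0 a1] a2]; case: b => [[b0 b1] b2]; case: c => [[c0 c1] c2].
rewrite /cross /dot /=; split; ring.
Qed.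

Section Coordinates.
Variables a b c : k * k * k.
Hypothesis abc : dot (cross a b) c != 0.
Let D := dot (cross a b) c.

Definition coord : {rmorphism {poly {poly {poly k}}} -> SS k} :=
  adjoin (adjoin (adjoin kC (lform a)) (lform b)) (lform c).

Lemma coordC x : coord x%:P%:P%:P = kC x.
Proof. by rewrite /coord !adjoinC. Qed.
Lemma coord0 : coord 'X%:P%:P = lform a.
Proof. by rewrite /coord !adjoinC adjoinX. Qed.
Lemma coord1 : coord 'X%:P = lform b.
Proof. by rewrite /coord adjoinC adjoinX. Qed.
Lemma coord2 : coord 'X = lform c.
Proof. by rewrite /coord adjoinX. Qed.

Lemma coord_bij : bijective coord.
Proof.
have [f fE] : exists f : {rmorphism k -> {poly {poly {poly k}}}}, forall x, f x = x%:P%:P%:P.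
  by exists (polyC \o (polyC \o polyC)).
have DC : f D^-1 * f D = 1 by rewrite -rmorphM mulVf ?rmorph1.
have DS : kC D^-1 * kC D = 1 by rewrite -rmorphM mulVf ?rmorph1.
pose w g := f (g (cross b c)) * 'X%:P%:P + f (g (cross c a)) * 'X%:P + f (g (cross a b)) * 'X.
have [h [h0 h1 h2]] : exists h : 'I_3 -> {poly {poly {poly k}}},
    [/\ h (inord 0) = f D^-1 * w (fun v => v.1.1),
        h (inord 1) = f D^-1 * w (fun v => v.1.2) &
        h (inord 2) = f D^-1 * w (fun v => v.2)].
  exists (fun i => nth 0 [:: f D^-1 * w (fun v => v.1.1); f D^-1 * w (fun v => v.1.2);
                           f D^-1 * w (fun v => v.2)] i).
  by rewrite !inordK.
have [g [gC gX]] : exists g : {rmorphism SS k -> {poly {poly {poly k}}}},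
    (forall x, g (kC x) = f x) /\ (forall i, g 'X_i = h i).
  by exists (mmap f h); split=> [x|i] /=; rewrite ?mmapC ?mmapX ?mmap1U.
have gL v : g (lform v) = f D^-1 * (f v.1.1 * w (fun v => v.1.1)
    + f v.1.2 * w (fun v => v.1.2) + f v.2 * w (fun v => v.2)).
  rewrite !rmorphD !rmorphM (gC v.1.1) (gC v.1.2) (gC v.2) !gX h0 h1 h2; ring.
have [La Lb Lc] := cramer_inv f a b c 'X%:P%:P 'X%:P 'X.
have e0 : g (coord 'X%:P%:P) = 'X%:P%:P by rewrite coord0 gL La mulrA DC mul1r.
have e1 : g (coord 'X%:P) = 'X%:P by rewrite coord1 gL Lb mulrA DC mul1r.
have e2 : g (coord 'X) = 'X by rewrite coord2 gL Lc mulrA DC mul1r.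
have eC x : g (coord x%:P%:P%:P) = x%:P%:P%:P.
  exact: etrans (congr1 g (coordC x)) (etrans (gC x) (fE x)).
exists g => [p|p].
  suff H : g \o coord =1 idfun by exact: H.
  apply: rmorph_poly_eq => [q|]; last exact: e2.
  move: q; apply: (@rmorph_poly_eq _ _ ((g \o coord) \o polyC) polyC) => [q|]; last exact: e1.
  move: q; apply: (@rmorph_poly_eq _ _ (((g \o coord) \o polyC) \o polyC) (polyC \o polyC)) => [x|].
    exact: eC.
  exact: e0.
suff H : coord \o g =1 idfun by exact: H.
have cf x : coord (f x) = kC x by rewrite fE coordC.
have [Lx Ly Lz] : let L g := kC (g (cross b c)) * lform a + kC (g (cross c a)) * lform b
    + kC (g (cross a b)) * lform c in
  [/\ L (fun v => v.1.1) = kC D * vS k 0, L (fun v => v.1.2) = kC D * vS k 1 &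
      L (fun v => v.2) = kC D * vS k 2] by exact: cramer.
apply: rmorph_mpoly_eq => [x|i].
  by rewrite /= (gC x) cf.
rewrite -[i]inord_val /=; case: {i}(nat_of_ord i) (ltn_ord i) => [|[|[|//]]] _; rewrite gX.
- by rewrite h0 rmorphM cf 2!rmorphD 3!rmorphM !cf coord0 coord1 coord2 Lx mulrA DS mul1r.
- by rewrite h1 rmorphM cf 2!rmorphD 3!rmorphM !cf coord0 coord1 coord2 Ly mulrA DS mul1r.
- by rewrite h2 rmorphM cf 2!rmorphD 3!rmorphM !cf coord0 coord1 coord2 Lz mulrA DS mul1r.
Qed.

Lemma reg_coord (I : SS k -> Prop) u : reg (fun u => I (coord u)) u -> reg I (coord u).
Proof. by apply: reg_iso => t; have [g _ gK] := coord_bij; exists (g t). Qed.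

End Coordinates.
End LinearForms.

Section ZeroIdeal.
Definition zeroI (T : comNzRingType) (x : T) := x = 0.

Lemma zeroI_ideal (T : comNzRingType) : is_ideal (@zeroI T).
Proof.
split=> [|a b -> ->|r a ->] //; first by rewrite /zeroI addr0.
by rewrite /zeroI mulr0.
Qed.

Lemma reg_zeroI (T : idomainType) (x : T) : x != 0 -> reg (@zeroI T) x.
Proof. by move=> x0 g /eqP; rewrite mulf_eq0 (negPf x0) => /eqP. Qed.

Lemma ext_zeroI (A : comNzRingType) (f : {poly A}) : ext (@zeroI A) f <-> zeroI f.
Proof. by split=> [f0|-> i]; [apply/polyP => i; rewrite coef0; apply: f0|rewrite coef0]. Qed.

Lemma addI_zeroP (T : comNzRingType) (x f : T) : addI (@zeroI T) x f <-> exists d, f = d * x.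
Proof.
apply: iff_trans (addIP _ _ (zeroI_ideal T)) _.
by split=> -[d]; [move/eqP; rewrite subr_eq0 => /eqP ->|move=> ->]; exists d; rewrite ?subrr.
Qed.

Lemma eq_addI (T : comNzRingType) (I J : T -> Prop) x f :
  (forall g, I g <-> J g) -> addI I x f <-> addI J x f.
Proof. by move=> IJ; apply: eq_ideal_gen => h; split=> -[/IJ|]; [left|right|left|right]. Qed.

Lemma addI_swap (T : comNzRingType) (I : T -> Prop) x y f :
  addI (addI I x) y f <-> addI (addI I y) x f.
Proof.
have H u v : ideal_sub (addI (addI I u) v) (addI (addI I v) u).
  apply: ideal_gen_min => [|h [| ->]]; first exact: addI_ideal.
    move: h; apply: ideal_gen_min => [|h [Ih| ->]]; first exact: addI_ideal.
      by apply: mem_ideal_gen; left; apply: mem_ideal_gen; left.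
    by apply: mem_ideal_gen; right.
  by apply: mem_ideal_gen; left; apply: mem_ideal_gen; right.
by split; apply: H.
Qed.
End ZeroIdeal.

Section PlaneRegularity.
Variable k : fieldType.
Implicit Types (a b c : k * k * k) (p q : {poly k}).
Local Notation Z0 := (@zeroI (SS k)).

Definition alg_eval q (x : SS k) : SS k := adjoin (kC k) x q.

Lemma hp_coord0 a b c q : alg_eval q (lform a) = coord a b c q%:P%:P.
Proof. by rewrite /coord !adjoinC. Qed.
Lemma hp_coord1 a b c q : alg_eval q (lform b) = coord a b c (map_poly polyC q)%:P.
Proof.
rewrite /coord adjoinC; move: q.
apply: (@rmorph_poly_eq _ _ _ (adjoin _ _ \o map_poly polyC)) => [x|].
  by rewrite /= map_polyC /= /alg_eval !adjoinC.
by rewrite /= map_polyX /alg_eval !adjoinX.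
Qed.
Lemma hp_coord2 a b c q : alg_eval q (lform c) = coord a b c (map_poly (polyC \o polyC) q).
Proof.
move: q; apply: (@rmorph_poly_eq _ _ _ (coord a b c \o map_poly (polyC \o polyC))) => [x|].
  by rewrite /= map_polyC /= /alg_eval /coord !adjoinC.
by rewrite /= map_polyX /alg_eval /coord !adjoinX.
Qed.

Section Triple.
Variables a b c : k * k * k.
Hypothesis abc : dot (cross a b) c != 0.

Let zero_coord u : Z0 (coord a b c u) <-> zeroI u.
Proof.
by split=> [/eqP|->]; rewrite /zeroI ?rmorph0 // -(rmorph0 (coord a b c)) (bij_eq (coord_bij abc)) => /eqP.
Qed.

Let ext2_zero (u : {poly {poly {poly k}}}) : Z0 (coord a b c u) <-> ext (ext (@zeroI _)) u.
Proof.
apply: iff_trans (zero_coord u) _; apply: iff_trans (iff_sym (ext_zeroI u)) _.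
by split=> H i; apply/ext_zeroI; apply: H.
Qed.

Let extS (A : comNzRingType) (I J : A -> Prop) (u : {poly A}) :
  (forall x, I x <-> J x) -> ext I u <-> ext J u.
Proof. by move=> IJ; split=> H i; apply/IJ. Qed.

Let ei1 (A : comNzRingType) (I : A -> Prop) := @ext_ideal A I.
Let z1 := zeroI_ideal {poly k}.

Let add_q q (u : {poly {poly {poly k}}}) : addI Z0 (alg_eval q (lform a)) (coord a b c u) <->
  ext (ext (addI (@zeroI _) q)) u.
Proof.
rewrite (hp_coord0 a b c); apply: iff_trans (iff_sym (addI_iso _ _ _ (coord_bij abc))) _.
apply: iff_trans (eq_addI _ _ ext2_zero) _.
apply: iff_trans (ext_addI _ _ (ei1 z1)) _.
by apply: extS => x; apply: ext_addI.
Qed.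

Let add_qp q p (u : {poly {poly {poly k}}}) :
  addI (addI Z0 (alg_eval q (lform a))) (alg_eval p (lform b)) (coord a b c u) <->
  ext (addI (ext (addI (@zeroI _) q)) (map_poly polyC p)) u.
Proof.
rewrite (hp_coord1 a b c); apply: iff_trans (iff_sym (addI_iso _ _ _ (coord_bij abc))) _.
apply: iff_trans (eq_addI _ _ (add_q q)) _.
by apply: ext_addI; apply/ei1/addI_ideal.
Qed.

Lemma reg_form_form : reg (addI Z0 (lform a)) (lform b).
Proof.
rewrite -(coord1 a b c) -[lform a](adjoinX (kC k)) -/(alg_eval 'X (lform a)); apply: reg_coord => //.
apply: eq_reg (fun u => iff_sym (add_q 'X u)) _; apply: reg_extC.
by apply: reg_ext_monic (monicX _); apply: addI_ideal.
Qed.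

Lemma reg_hp_form q : reg (addI Z0 (alg_eval q (lform a))) (lform c).
Proof.
rewrite -[lform c](coord2 a b); apply: reg_coord => //.
apply: eq_reg (fun u => iff_sym (add_q q u)) _.
by apply: reg_ext_monic (monicX _); apply/ei1/addI_ideal.
Qed.

Lemma reg_hp_hp_form q p :
  reg (addI (addI Z0 (alg_eval q (lform a))) (alg_eval p (lform b))) (lform c).
Proof.
rewrite -[lform c](coord2 a b); apply: reg_coord => //.
apply: eq_reg (fun u => iff_sym (add_qp q p u)) _.
by apply: reg_ext_monic (monicX _); apply: addI_ideal.
Qed.

Lemma reg_hp_hp q p : p \is monic -> reg (addI Z0 (alg_eval q (lform a))) (alg_eval p (lform b)).
Proof.
move=> mp; rewrite (hp_coord1 a b c); apply: reg_coord => //.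
apply: eq_reg (fun u => iff_sym (add_q q u)) _; apply: reg_extC.
by apply: reg_ext_monic; [apply: addI_ideal|rewrite map_monic].
Qed.

(** In the coordinates [a], [b], [c] the power is extended from the first two variables, and the
    element is monic in the third. *)
Lemma reg_pow_hp m q : q \is monic ->
  reg (ideal_pow (ideal_gen (fun h => h = lform a \/ h = lform b)) m) (alg_eval q (lform c)).
Proof.
move=> mq; rewrite (hp_coord2 a b); apply: reg_coord => //.
pose I0 := ideal_gen (fun h : {poly {poly k}} => h = 'X%:P \/ h = 'X).
apply: (@eq_reg _ (ext (ideal_pow I0 m))) => [u|]; last first.
  by apply: reg_ext_monic; [apply: ideal_pow_ideal|rewrite map_monic].
apply: iff_trans (iff_sym (ext_pow _ _ (ideal_gen_ideal _))) _.
apply: iff_sym; apply: iff_trans (ideal_pow_iso _ _ _ (coord_bij abc)) _.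
apply: eq_ideal_pow => h; apply: iff_trans (ideal_gen_iso _ _ (coord_bij abc)) _.
apply: iff_trans (ext_gen _ _); apply: eq_ideal_gen => g.
have inj := bij_inj (coord_bij abc).
split=> [[E|E]|[g' [->|->] ->]].
- by exists 'X%:P; [left|apply: inj; rewrite E coord0].
- by exists 'X; [right|apply: inj; rewrite E coord1].
- by left; rewrite coord0.
- by right; rewrite coord1.
Qed.

Lemma hp_neq0 q : q != 0 -> alg_eval q (lform a) != 0.
Proof.
by move=> q0; rewrite (hp_coord0 a b c) -(rmorph0 (coord a b c)) (bij_eq (coord_bij abc)) !polyC_eq0.
Qed.

End Triple.
End PlaneRegularity.

(** * Products of lines, grading and saturation *)

Section Products.
Variable k : fieldType.
Implicit Types (a b c : k * k * k) (p q : {poly k}) (s : seq (k * k * k)).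
Local Notation Z0 := (@zeroI (SS k)).

Definition prodF s : SS k := \prod_(b <- s) lform b.

Lemma reg_prod (T : comNzRingType) (I : T -> Prop) (X : eqType) (s : seq X) (F : X -> T) :
  (forall x, x \in s -> reg I (F x)) -> reg I (\prod_(x <- s) F x).
Proof.
elim: s => [|x s IHs] H; first by rewrite big_nil => g; rewrite mul1r.
rewrite big_cons; apply: regM; first by apply: H; rewrite mem_head.
by apply: IHs => y ys; apply: H; rewrite inE ys orbT.
Qed.

(** Each factor of [F] is a coordinate independent of [a] and [b], hence regular modulo [q(a)]; so
    is [F], and the two are exchanged. A member of the non-empty [s] completes the coordinates. *)
Lemma reg_prodF_hp s a b q : q != 0 ->
  (forall x, x \in s -> dot (cross a b) x != 0) -> s != [::] ->
  reg (addI Z0 (prodF s)) (alg_eval q (lform a)).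
Proof.
case: s => // x0 s q0 H _; apply: reg_swap; first exact: zeroI_ideal.
  by apply/reg_zeroI/(hp_neq0 (H x0 (mem_head _ _))).
by apply: reg_prod => x xs; apply: (reg_hp_form (H x xs)).
Qed.

Lemma reg_prodF_hp_hp s a b q p : p \is monic ->
  (forall x, x \in s -> dot (cross a b) x != 0) -> s != [::] ->
  reg (addI (addI Z0 (prodF s)) (alg_eval q (lform a))) (alg_eval p (lform b)).
Proof.
case: s => // x0 s mp H _; apply: (@eq_reg _ (addI (addI Z0 (alg_eval q (lform a))) (prodF (x0 :: s)))).
  by move=> f; apply: addI_swap.
apply: reg_swap; first exact: addI_ideal.
  by apply: (reg_hp_hp (H x0 (mem_head _ _))).
by apply: reg_prod => x xs; apply: (reg_hp_hp_form (H x xs)).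
Qed.
End Products.

Section Grading.
Variable k : fieldType.
Local Notation C := (kC k).

(* [grade f] has the homogeneous component of degree [n] of [f] as its
   coefficient of degree [n]. *)
Definition grade : {rmorphism SS k -> {poly (SS k)}} :=
  mmap (polyC \o C) (fun i => ('X_i)%:P * 'X).

Definition homogeneous (I : SS k -> Prop) := forall f, I f -> ext I (grade f).

Lemma gradeC c : grade (C c) = (C c)%:P.
Proof. by rewrite /grade /= mmapC. Qed.
Lemma gradeX i : grade 'X_i = ('X_i)%:P * 'X.
Proof. by rewrite /grade /= mmapX mmap1U. Qed.

Lemma grade_lform a : grade (lform a) = (lform a)%:P * 'X.
Proof. by rewrite /lform /vS !rmorphD !rmorphM /= !gradeC !gradeX; ring. Qed.

Lemma grade_eval1 f : (grade f).[1] = f.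
Proof.
suff H : horner_eval 1 \o grade =1 idfun by exact: H.
apply: rmorph_mpoly_eq => [c|i]; rewrite /= /horner_eval.
  by rewrite gradeC hornerC.
by rewrite gradeX hornerM hornerC hornerX mulr1.
Qed.

Lemma homogeneous_grade (I : SS k -> Prop) f : is_ideal I -> ext I (grade f) -> I f.
Proof.
move=> iI If; rewrite -[f]grade_eval1 horner_coef; apply: ideal_sum => // i _.
by apply: idealMr.
Qed.

Lemma homogeneous_gen (G : SS k -> Prop) :
  (forall g, G g -> ext (ideal_gen G) (grade g)) -> homogeneous (ideal_gen G).
Proof.
have iG := ext_ideal (ideal_gen_ideal G).
move=> hG; have H := @ideal_gen_min _ G (fun f => ext (ideal_gen G) (grade f)).
refine (H _ hG); split=> [|a b|r a].
- by rewrite rmorph0; apply: ideal0.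
- by rewrite rmorphD; apply: idealD.
- by rewrite rmorphM; apply: idealM.
Qed.

Lemma homogeneous_pow I n : homogeneous I -> homogeneous (ideal_pow I n).
Proof.
move=> hI; elim: n => [|n IHn]; first by move=> f _ i; apply: ideal_pow0.
apply: homogeneous_gen => _ [a [b [Ia Ib ->]]] i.
rewrite rmorphM coefM; apply: ideal_sum => [|j _]; first exact: ideal_gen_ideal.
apply: mem_ideal_gen; exists (grade a)`_j, (grade b)`_(i - j); split=> //; first exact: hI.
exact: IHn.
Qed.

Lemma ext_monomial (I : SS k -> Prop) x n : is_ideal I -> I x -> ext I (x%:P * 'X^n).
Proof. by move=> iI Ix; apply: (@idealMr _ (ext I)); [apply: ext_ideal|apply/extC]. Qed.

Lemma homogeneous_forms a b :
  homogeneous (ideal_gen (fun h => h = lform a \/ h = lform b)).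
Proof.
apply: homogeneous_gen => g [] ->; rewrite grade_lform -['X]expr1;
  apply: ext_monomial; try exact: ideal_gen_ideal; apply: mem_ideal_gen; by [left|right].
Qed.

Lemma grade_prodF s : grade (prodF s) = (prodF s)%:P * 'X^(size s).
Proof.
rewrite /prodF; elim: s => [|a s IHs]; first by rewrite !big_nil rmorph1 mulr1.
by rewrite !big_cons rmorphM IHs /= grade_lform polyCM exprS; ring.
Qed.

Lemma homogeneous_addI_prodF I s : homogeneous I -> homogeneous (addI I (prodF s)).
Proof.
move=> hI; apply: homogeneous_gen => g [Ig i| ->].
  by apply: mem_ideal_gen; left; apply: hI.
rewrite grade_prodF; apply: ext_monomial; first exact: addI_ideal.
by apply: mem_ideal_gen; right.
Qed.

Lemma grade_hp q a : grade (alg_eval q (lform a)) = adjoin (polyC \o C) ((lform a)%:P * 'X) q.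
Proof.
move: q; apply: (@rmorph_poly_eq _ _ (grade \o adjoin C (lform a)) (adjoin _ _)) => [x|].
  by rewrite /= !adjoinC gradeC.
by rewrite /= !adjoinX grade_lform.
Qed.

(** Write [q = X^m r] with [r(0)] non-zero. Powers of the form are regular, and [r] of the form has
    the unit [r(0)] as component of degree 0, so the components of [g] enter [I] from the lowest
    degree up. *)
Lemma reg_homogeneous_hp I a q : is_ideal I -> homogeneous I -> q != 0 ->
  reg I (lform a) -> reg I (alg_eval q (lform a)).
Proof.
move=> iI hI q0 ra; have [m [r /implyP/(_ q0) r0 ->]] := multiplicity_XsubC q 0.
rewrite subr0 /alg_eval rmorphM rmorphXn adjoinX; apply: regM; last first.
  elim: (m) => [|n IHn]; first by move=> g; rewrite mul1r.
  by rewrite exprS; apply: regM.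
move=> g Ig; apply: homogeneous_grade => //.
have := hI _ Ig; rewrite rmorphM; apply: (@reg_ext_coef0 _ _ _ (C r.[0]^-1)) => //.
suff -> : (grade (adjoin C (lform a) r))`_0 = C r.[0].
  by rewrite -rmorphM mulVf ?rmorph1.
rewrite -/(alg_eval r (lform a)) grade_hp -horner_coef0 -/(horner_eval 0 _) -/(horner_eval 0 r).
move: {r0 Ig} r; apply: (@rmorph_poly_eq _ _ (horner_eval 0 \o adjoin _ _) (C \o horner_eval 0)) => [x|].
  by rewrite /= adjoinC /horner_eval !hornerC.
by rewrite /= adjoinX /horner_eval hornerM !hornerX mulr0 rmorph0.
Qed.
End Grading.

Section Saturation.
Variable k : fieldType.
Implicit Types (a b c : k * k * k).

Lemma ideal_powD (T : comNzRingType) (I : T -> Prop) n1 n2 f :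
  ideal_pow I (n1 + n2) f -> ideal_prod (ideal_pow I n1) (ideal_pow I n2) f.
Proof.
have iP n : is_ideal (ideal_prod (ideal_pow I n) (ideal_pow I n2)) by apply: ideal_gen_ideal.
elim: n1 f => [|n1 IHn] f.
  move=> If; apply: mem_ideal_gen; exists 1, f; rewrite mul1r; split=> //.
  exact: ideal_pow0.
move: f; apply: ideal_gen_min => // _ [a [b [Ia /IHn Ib ->]]].
move: b Ib; refine (ideal_gen_min (I := fun y : T => ideal_prod (ideal_pow I n1.+1) (ideal_pow I n2) (a * y)) _ _).
  split=> [|x y|r x]; first by rewrite mulr0; apply: ideal0.
    by rewrite mulrDr; apply: idealD.
  by rewrite mulrCA; apply: idealM.
move=> _ [c [d [Ic Id ->]]]; rewrite mulrA; apply: mem_ideal_gen; exists (a * c), d; split=> //.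
by apply: mem_ideal_gen; exists a, c.
Qed.

Lemma ideal_powS (T : comNzRingType) (I J : T -> Prop) n :
  ideal_sub I J -> ideal_sub (ideal_pow I n) (ideal_pow J n).
Proof.
move=> IJ; elim: n => [|n IHn] f; first by move=> _; apply: ideal_pow0.
move: f; apply: ideal_genS => _ [a [b [/IJ Ja /IHn Jb ->]]].
by apply: mem_ideal_gen; exists a, b.
Qed.

Lemma ideal_pow_addI (T : comNzRingType) (I : T -> Prop) x n : is_ideal I ->
  ideal_sub (ideal_pow (addI I x) n) (addI (ideal_pow I n) x).
Proof.
move=> iI; have iP := ideal_pow_ideal I.
elim: n => [|n IHn] f; first by move=> _; apply: mem_ideal_gen; left; apply: ideal_pow0.
move: f; apply: ideal_gen_min; first exact: addI_ideal.
move=> _ [a [b [/(addIP _ _ iI) [d Id] /IHn /(addIP _ _ (iP n)) [e Ie] ->]]].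
apply/(addIP _ _ (iP n.+1)); exists (d * b + (a - d * x) * e).
rewrite (_ : _ - _ = (a - d * x) * (b - e * x)); last by ring.
by apply: mem_ideal_gen; exists (a - d * x), (b - e * x).
Qed.

Lemma vS_span a b c i : dot (cross a b) c != 0 -> (i < 3)%N -> exists x y z,
  vS k i = kC k x * lform a + kC k y * lform b + kC k z * lform c.
Proof.
move=> abc i3.
have DS : kC k (dot (cross a b) c)^-1 * kC k (dot (cross a b) c) = 1.
  by rewrite -rmorphM mulVf ?rmorph1.
have [Lx Ly Lz] : let L g := kC k (g (cross b c)) * lform a + kC k (g (cross c a)) * lform b
    + kC k (g (cross a b)) * lform c in let D := dot (cross a b) c in
  [/\ L (fun v => v.1.1) = kC k D * vS k 0, L (fun v => v.1.2) = kC k D * vS k 1 &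
      L (fun v => v.2) = kC k D * vS k 2] by exact: cramer.
have H (x y z : k) w : kC k x * lform a + kC k y * lform b + kC k z * lform c
    = kC k (dot (cross a b) c) * w ->
  w = kC k ((dot (cross a b) c)^-1 * x) * lform a + kC k ((dot (cross a b) c)^-1 * y) * lform b
     + kC k ((dot (cross a b) c)^-1 * z) * lform c.
  move=> E; rewrite -[w]mul1r -DS -mulrA -E !(rmorphM (kC k) (dot (cross a b) c)^-1); ring.
case: i i3 => [|[|[|//]]] _; eexists; eexists; eexists; apply: H; first [exact: Lx|exact: Ly|exact: Lz].
Qed.

Lemma irrS_sub a b c : dot (cross a b) c != 0 ->
  ideal_sub (@irrS k) (addI (ideal_gen (fun h => h = lform a \/ h = lform b)) (lform c)).
Proof.
move=> abc; set I := ideal_gen _; have iK := addI_ideal I (lform c).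
have [Ka Kb Kc] : [/\ addI I (lform c) (lform a), addI I (lform c) (lform b) &
    addI I (lform c) (lform c)].
  by split; apply: mem_ideal_gen; [left; apply: mem_ideal_gen; left|
    left; apply: mem_ideal_gen; right|right].
have KV i : (i < 3)%N -> addI I (lform c) (vS k i).
  move=> /(vS_span abc) [x [y [z ->]]].
  by apply: idealD => //; [apply: idealD => //|]; apply: idealM.
by apply: ideal_gen_min => // h; case=> [|[]] ->; apply: KV.
Qed.

(** Geometrically, the ideal of the fat points of the plane over which the vertical lines lie. *)
Definition Jv (vs : seq (k * k * k * (k * k * k) * nat)) (g : SS k) :=
  forall p, p \in vs ->
    ideal_pow (ideal_gen (fun h => h = lform p.1.1 \/ h = lform p.1.2)) p.2 g.

Lemma Jv_ideal vs : is_ideal (Jv vs).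
Proof.
split=> [p _|a b Ja Jb p pv|r a Ja p pv]; first exact: (ideal0 (ideal_pow_ideal _ _)).
  by apply: idealD; [apply: ideal_pow_ideal|apply: Ja|apply: Jb].
by apply: idealM; [apply: ideal_pow_ideal|apply: Ja].
Qed.

Lemma Jv_homogeneous vs : homogeneous (Jv vs).
Proof.
move=> f Jf i p pv; apply: homogeneous_pow; first exact: homogeneous_forms.
exact: Jf.
Qed.

Lemma Jv_reg_hp vs c q : (forall p, p \in vs -> dot (cross p.1.1 p.1.2) c != 0) ->
  q \is monic -> reg (Jv vs) (alg_eval q (lform c)).
Proof. by move=> H mq g Jg p pv; apply: (reg_pow_hp (H p pv) mq); apply: Jg. Qed.

(** When [c] misses the point cut out by [a], [b], the ideal [irr] lies in [(a, b, c)] and its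
    [m]-th power in [(a, b)^m + (c)]. The product over all points lands in their intersection modulo
    [c]. *)
Lemma irrS_pow_sub vs c : (forall p, p \in vs -> dot (cross p.1.1 p.1.2) c != 0) ->
  exists n, ideal_sub (ideal_pow (@irrS k) n) (addI (Jv vs) (lform c)).
Proof.
elim: vs => [|p vs IHvs] H.
  by exists 0%N => f _; apply: mem_ideal_gen; left.
have [|n Hn] := IHvs; first by move=> q qv; apply: H; rewrite inE qv orbT.
exists (p.2 + n)%N => f /ideal_powD; move: f; apply: ideal_gen_min.
  exact: addI_ideal.
move=> _ [x [y [Ix /Hn /(addIP _ _ (Jv_ideal _)) [e Je] ->]]].
have := ideal_powS (irrS_sub (H p (mem_head _ _))) Ix.
move/(ideal_pow_addI (ideal_gen_ideal _))/(addIP _ _ (ideal_pow_ideal _ _)) => [d Id].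
apply/(addIP _ _ (Jv_ideal _)); exists (d * y + (x - d * lform c) * e).
rewrite (_ : _ - _ = (x - d * lform c) * (y - e * lform c)); last by ring.
move=> q; rewrite inE => /orP [/eqP ->|qv].
  by apply: idealMr => //; apply: ideal_pow_ideal.
by apply: idealM; [apply: ideal_pow_ideal|apply: Je].
Qed.

(** If [c g] is in [H], so is [(J + (c)) g], which contains some power of [irr] times [g];
    saturation puts [g] in [H]. Homogeneity then passes from [c] to [q(c)]. *)
Lemma saturated_reg_hp vs s c q :
  (forall p, p \in vs -> dot (cross p.1.1 p.1.2) c != 0) -> q != 0 ->
  saturated_wrt (@irrS k) (addI (Jv vs) (prodF s)) ->
  reg (addI (Jv vs) (prodF s)) (alg_eval q (lform c)).
Proof.
move=> H q0 sat; apply: reg_homogeneous_hp => //; first exact: addI_ideal.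
  exact/homogeneous_addI_prodF/Jv_homogeneous.
move=> g Hg; apply: sat; have [n Hn] := irrS_pow_sub H; exists n => r /Hn.
move/(addIP _ _ (Jv_ideal _)) => [d Jd].
rewrite (_ : g * r = g * (r - d * lform c) + d * (lform c * g)); last by ring.
apply: idealD; [exact: addI_ideal| |by apply: idealM; [apply: addI_ideal|]].
by apply: idealM; [apply: addI_ideal|apply: mem_ideal_gen; left].
Qed.
End Saturation.

(** * General linear forms *)

Section GenericPosition.
Variable k : fieldType.
Hypothesis char0 : [pchar k] =i pred0.
Implicit Types (a b c n : k * k * k).

Definition moment (t : k) : k * k * k := (1, t, t ^+ 2).

(** On the moment curve a non-zero vector becomes a non-zero polynomial in [t]. In characteristic
    zero the integers outnumber the roots of the product of these polynomials. *)
Lemma generic_moment (ns : seq (k * k * k)) :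
  (forall n, n \in ns -> n != 0) -> exists t, forall n, n \in ns -> dot n (moment t) != 0.
Proof.
move=> n0; pose pol n : {poly k} := n.1.1%:P + n.1.2 *: 'X + n.2 *: 'X^2.
have polE n t : (pol n).[t] = dot n (moment t).
  by rewrite /pol /dot /= !hornerE; ring.
pose P := \prod_(n <- ns) pol n.
have P0 : P != 0.
  rewrite prodf_seq_neq0; apply/allP => -[[x y] z] /n0; apply: contra => /eqP /polyP E.
  have := E 0%N; have := E 1%N; have := E 2%N.
  by rewrite /pol !coefE /= !(mulr0, mulr1, addr0, add0r) => -> -> ->.
have [t Pt] : exists t, ~~ root P t.
  apply: boolp.contrapT => no; have all_root t : root P t.
    by apply/negPn/negP => Pt; apply: no; exists t.
  have inj : injective (fun i : nat => i%:R : k).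
    suff H i j : (i <= j)%N -> i%:R = j%:R :> k -> i = j.
      by move=> i j ij; case/orP: (leq_total i j) => /H; [apply|move=> ->].
    move=> ij /eqP; rewrite eq_sym -subr_eq0 -natrB // ((pcharf0P k).1 char0) subn_eq0 => ji.
    by apply/eqP; rewrite eqn_leq ij.
  pose rs := [seq (i%:R : k) | i <- iota 0 (size P)].
  have rs_root : all (root P) rs by apply/allP.
  have rs_uniq : uniq rs by rewrite map_inj_uniq ?iota_uniq.
  by have := max_poly_roots P0 rs_root rs_uniq; rewrite size_map size_iota ltnn.
exists t => n nn; rewrite -polE; move: Pt; rewrite /root horner_prod prodf_seq_neq0.
by move/allP/(_ n nn).
Qed.

Lemma cross_neq0 b : b != 0 -> exists e, cross e b != 0.
Proof.
case: b => [[x y] z] b0; have [y0|y0] := eqVneq y 0; last first.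
  by exists (1, 0, 0); apply: contra_neq y0 => -[]; rewrite !mul0r !mul1r !subr0.
have [z0|z0] := eqVneq z 0; last first.
  by exists (1, 0, 0); apply: contra_neq z0 => -[_ /eqP]; rewrite !mul0r !mul1r sub0r oppr_eq0 => /eqP.
exists (0, 1, 0); apply: contra_neq b0 => -[_ _ /eqP].
by rewrite y0 z0 !mul0r mul1r sub0r oppr_eq0 => /eqP ->.
Qed.

Lemma generic_pair (vs : seq (k * k * k * (k * k * k) * nat)) (s : seq (k * k * k)) :
  (forall p, p \in vs -> cross p.1.1 p.1.2 != 0) -> (forall b, b \in s -> b != 0) ->
  exists l l', (forall p, p \in vs -> dot (cross p.1.1 p.1.2) l != 0) /\
    (forall b, b \in s -> dot (cross l l') b != 0).
Proof.
(* Before [l'] can be chosen, [cross b l] must be non-zero. As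
   [dot (cross e b) l = dot e (cross b l)], it suffices that [l] avoids the vector [cross e b]. *)
move=> vs0 s0; have [e ee] : exists e, forall b, b \in s -> cross (e b) b != 0.
  suff /boolp.choice [e He] : forall b, exists e, b \in s -> cross e b != 0 by exists e.
  by move=> b; have [/s0/cross_neq0 [e He]|_] := boolP (b \in s); [exists e|exists 0].
have [|t Ht] := generic_moment (ns := [seq cross p.1.1 p.1.2 | p <- vs] ++ [seq cross (e b) b | b <- s]).
  by move=> n; rewrite mem_cat => /orP [] /mapP [x xs ->]; [apply: vs0|apply: ee].
pose l := moment t.
have lb b : b \in s -> cross b l != 0.
  move=> bs; have : dot (cross (e b) b) l != 0.
    by apply: Ht; rewrite mem_cat; apply/orP; right; apply: map_f.
  apply: contra_neq => bl.
  transitivity (dot (e b) (cross b l)); first by rewrite /dot /cross /=; ring.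
  by rewrite bl /dot /= !mulr0 !addr0.
have [|t' Ht'] := generic_moment (ns := [seq cross b l | b <- s]).
  by move=> n /mapP [b bs ->]; apply: lb.
exists l, (moment t'); split=> [p pv|b bs].
  by apply: Ht; rewrite mem_cat; apply/orP; left; apply: (map_f (fun p => cross p.1.1 p.1.2)).
have := Ht' _ (map_f (fun b => cross b l) bs).
by congr (_ != _); rewrite /dot /cross /=; ring.
Qed.
End GenericPosition.

(** * The ideal of the lines in a hyperplane *)

Section LinearIdeal.
Variable k : fieldType.
Implicit Types (a b c : k * k * k).
Local Notation Z0 := (@zeroI (SS k)).

(** Non-proportional forms are regular modulo each other, so the principal ideals of the forms
    intersect in [(F)]; this makes [(sigma, F)] the ideal of the horizontal lines. *)
Lemma prodF_dvd s f : pairwise (fun b b' => cross b b' != 0) s ->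
  [pchar k] =i pred0 ->
  (forall b, b \in s -> addI Z0 (lform b) f) <-> addI Z0 (prodF s) f.
Proof.
move=> + ch; elim: s f => [|b s IHs] f /=.
  split=> // _; apply/addI_zeroP; exists f.
  by rewrite /prodF big_nil mulr1.
case/andP => /allP bs ps; split=> [H|/addI_zeroP [d ->] x].
  have /addI_zeroP [g E] := H b (mem_head _ _).
  have /(IHs _ ps) /addI_zeroP [d Ed] : forall x, x \in s -> addI Z0 (lform x) g.
    move=> x xs; have [|t /(_ _ (mem_head _ _)) Ht] := generic_moment ch (ns := [:: cross x b]).
      move=> n; rewrite inE => /eqP ->; have := bs x xs; apply: contra_neq => xb.
      transitivity (0 - cross x b); last by rewrite xb subrr.
      rewrite /cross; apply/eqP; rewrite -subr_eq0; apply/eqP.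
      by congr ((_, _), _); rewrite /=; ring.
    apply: (reg_form_form Ht); rewrite mulrC -E.
    by apply: H; rewrite inE xs orbT.
  by apply/addI_zeroP; exists d; rewrite E Ed /prodF big_cons; ring.
rewrite inE => /orP [/eqP ->|xs].
  by apply/addI_zeroP; exists (d * prodF s); rewrite /prodF big_cons; ring.
have /(_ x xs) /addI_zeroP [e Ee] := (IHs (prodF s) ps).2 (mem_ideal_gen (or_intror erefl)).
by apply/addI_zeroP; exists (d * lform b * e); rewrite /prodF big_cons -/(prodF s) Ee; ring.
Qed.
End LinearIdeal.

Lemma coef0_subMC (A : comNzRingType) (g d : {poly A}) x q :
  (g - (d - x%:P) * q%:P)`_0 = g`_0 - (d`_0 - x) * q.
Proof. by rewrite coefB coef0M coefB !coefC. Qed.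

Lemma coef0_socle (A : comNzRingType) (g v : {poly A}) c x :
  ('X * g + c%:P - v * ('X + x%:P))`_0 = c - v`_0 * x.
Proof. by rewrite coefB coef0M !coefD coefXM coefX !coefC /= !add0r. Qed.

(** * Regular elements and socle modulo the ideal of the lines *)

Section HyperplaneIdeal.
Variable k : fieldType.
Implicit Types (vs : seq (k * k * k * (k * k * k) * nat)) (s : seq (k * k * k)) (g : {poly SS k}).
Local Notation Z0 := (@zeroI (SS k)).

(* The ideal [(sigma, F) /\ J] of [k[x,y,z][sigma]], with [sigma] the
   indeterminate ['X]. *)
Definition planeI vs s g := ext (Jv vs) g /\ addI Z0 (prodF s) g`_0.

Lemma planeI_ideal vs s : is_ideal (planeI vs s).
Proof.
have iJ := ext_ideal (Jv_ideal vs); have iF := addI_ideal Z0 (prodF s).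
split=> [|a b [Ja Fa] [Jb Fb]|r a [Ja Fa]]; split.
- exact: (ideal0 iJ).
- by rewrite coef0; apply: (ideal0 iF).
- exact: (idealD iJ).
- by rewrite coefD; apply: (idealD iF).
- exact: (idealM _ iJ).
- by rewrite coef0M; apply: (idealM _ iF).
Qed.

Variables (vs : seq (k * k * k * (k * k * k) * nat)) (s : seq (k * k * k)).
Variables (l l' : k * k * k).
Hypotheses (vl : forall p, p \in vs -> dot (cross p.1.1 p.1.2) l != 0)
           (sl : forall b, b \in s -> dot (cross l l') b != 0) (s0 : s != [::]).

Lemma reg_planeI_hp q : q \is monic -> reg (planeI vs s) (alg_eval q (lform l))%:P.
Proof.
move=> mq g [Jg Fg]; split.
  exact: (reg_extC (Jv_reg_hp vl mq)).
by apply: (reg_prodF_hp (monic_neq0 mq) sl s0); rewrite -coefCM.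
Qed.

Lemma monic_shift (x : SS k) (q : {poly k}) : q \is monic ->
  adjoin (polyC \o kC k) ('X + x%:P) q \is monic.
Proof.
move=> mq.
have -> : adjoin (polyC \o kC k) ('X + x%:P) q = map_poly (kC k) q \Po ('X + x%:P).
  by rewrite adjoinE map_poly_comp /comp_poly.
rewrite monicE lead_coef_comp ?size_XaddC //.
by rewrite lead_coefXaddC expr1n mulr1 -monicE map_monic.
Qed.

Lemma coef0_shift (x : SS k) (q : {poly k}) :
  (adjoin (polyC \o kC k) ('X + x%:P) q)`_0 = alg_eval q x.
Proof.
rewrite -horner_coef0 -/(horner_eval 0 _); move: q.
apply: (@rmorph_poly_eq _ _ (horner_eval 0 \o adjoin _ _) (adjoin (kC k) x)) => [c|].
  by rewrite /= !adjoinC /horner_eval hornerC.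
by rewrite /= !adjoinX /horner_eval !hornerE.
Qed.

(** [p(sigma + l')] is monic in [sigma], hence regular modulo [J] and [Q], and at [sigma = 0] it
    becomes [p(l')], regular modulo [F] and [Q]. Gluing the two conclusions is obstructed in [S/H],
    where saturation makes [Q] regular. *)
Lemma reg_planeI_shift q p : q \is monic -> p \is monic ->
  saturated_wrt (@irrS k) (addI (Jv vs) (prodF s)) ->
  reg (addI (planeI vs s) (alg_eval q (lform l))%:P)
      (adjoin (polyC \o kC k) ('X + (lform l')%:P) p).
Proof.
move=> mq mp sat g; set Q := alg_eval q (lform l); set a := adjoin _ _ _.
have iI := planeI_ideal vs s; have iJ := Jv_ideal vs; have iF := addI_ideal Z0 (prodF s).
move=> /(addIP _ _ iI) [d [Jd Fd]].
have [d1 J1] : exists d1, ext (Jv vs) (g - d1 * Q%:P).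
  apply/(addIP _ _ (ext_ideal iJ))/(ext_addI _ _ iJ).
  apply: (reg_ext_monic (addI_ideal _ _) (monic_shift (lform l') mp)); rewrite -/a.
  by apply/(ext_addI _ _ iJ)/(addIP _ _ (ext_ideal iJ)); exists d.
have [c0 F0] : exists c0, addI Z0 (prodF s) (g`_0 - c0 * Q).
  apply/(addIP _ _ iF)/(reg_prodF_hp_hp (q := q) mp sl s0)/(addIP _ _ iF); exists d`_0.
  by move: Fd; rewrite coefB !coef0M coefC coef0_shift.
have Hq := saturated_reg_hp vl (monic_neq0 mq) sat.
(* [d1] and [c0] are the multipliers of [Q] found modulo [J] and modulo [(sigma, F)]; [Q] kills
   their difference in [S/H]. *)
have : addI (Jv vs) (prodF s) (d1`_0 - c0).
  apply: Hq; rewrite -/Q (_ : _ * _ = (g`_0 - c0 * Q) - (g`_0 - d1`_0 * Q)); last first.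
    by generalize Q g`_0 d1`_0 => x y z; ring.
  have := J1 0%N; rewrite coefB coef0M coefC /= => J10.
  apply: idealB; first exact: addI_ideal; last by apply: mem_ideal_gen; left.
  by case/addI_zeroP: F0 => e ->; apply: idealM; [apply: addI_ideal|apply: mem_ideal_gen; right].
case/(addIP _ _ iJ) => e Je; set j2 := _ - _ in Je.
(* Subtracting [j2], an element of [J], makes the constant coefficient congruent to [c0] modulo [F]:
   one multiplier now serves both conditions. *)
apply/(addIP _ _ iI); exists (d1 - j2%:P); split.
  rewrite (_ : _ - _ = (g - d1 * Q%:P) + Q%:P * j2%:P); last by ring.
  by apply: (idealD (ext_ideal iJ)) => //; apply: (idealM _ (ext_ideal iJ)); apply/extC.
rewrite coef0_subMC.
rewrite (_ : _ - _ = (g`_0 - c0 * Q) - (e * Q) * prodF s); last first.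
  have -> : d1`_0 - j2 = c0 + e * prodF s by rewrite /j2 -addrA -opprD subKr.
  by generalize Q g`_0 (prodF s) => x y w; ring.
by apply: idealB => //; apply: idealM => //; apply: mem_ideal_gen; right.
Qed.

Lemma reg_planeI_linear : reg (planeI vs s) ('X + (lform l)%:P).
Proof.
move=> g [Jg Fg]; split.
  by apply: (reg_ext_monic (Jv_ideal vs) _ Jg); rewrite monicE lead_coefXaddC.
have := reg_prodF_hp (monic_neq0 (monicX k)) sl s0; rewrite /alg_eval adjoinX; apply.
by move: Fg; rewrite coef0M coefD coefX coefC add0r.
Qed.

(* The element [g sigma + F b] generates the socle of the quotient by
   [(sigma + l, tau)] which obstructs depth 3 when [g] is not in [J + (F)]. *)
Lemma socle_planeI (g : SS k) : (forall x, @irrS k x -> addI (Jv vs) (prodF s) (x * g)) ->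
  irrS (lform l) ->
  exists u : {poly SS k}, [/\ addI (planeI vs s) ('X + (lform l)%:P) ('X * u),
    forall x, @irrS k x -> addI (planeI vs s) ('X + (lform l)%:P) (x%:P * u) &
    addI (planeI vs s) ('X + (lform l)%:P) u -> addI (Jv vs) (prodF s) g].
Proof.
move=> soc irl; have iI := planeI_ideal vs s; have iJ := Jv_ideal vs.
have iF := addI_ideal Z0 (prodF s).
have coefXM0 (f : {poly SS k}) : ('X * f)`_0 = 0 by rewrite coefXM.
have extX f : Jv vs f -> ext (Jv vs) ('X * f%:P).
  by move=> Jf; apply: (idealM _ (ext_ideal iJ)); apply/extC.
have [b Jb] := (addIP _ _ iJ).1 (soc _ irl).
set h := 'X + _; exists ('X * g%:P + (b * prodF s)%:P); split.
- apply/(addIP _ _ iI); exists ('X * g%:P).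
  rewrite (_ : _ - _ = - ('X * (lform l * g - b * prodF s)%:P)).
    by apply: idealN => //; split; [apply: extX|rewrite coefXM0; apply: ideal0].
  by rewrite /h !(polyCB, polyCM); ring.
- move=> x irx; have [b' Jb'] := (addIP _ _ iJ).1 (soc _ irx).
  apply/(addIP _ _ iI); exists (b' * prodF s)%:P.
  rewrite (_ : _ - _ = 'X * (x * g - b' * prodF s)%:P + ((x * b - lform l * b') * prodF s)%:P).
    split; last first.
      by rewrite coefD coefXM0 add0r coefC; apply/addI_zeroP; eexists.
    apply: (idealD (ext_ideal iJ)); [exact: extX|apply/extC => //].
    rewrite (_ : _ * _ = lform l * (x * g - b' * prodF s) - x * (lform l * g - b * prodF s)); last by ring.
    by apply: (idealB iJ); apply: (idealM _ iJ).
  by rewrite /h !(polyCB, polyCM); ring.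
(* At [sigma = 0], [F] divides [l] times the constant coefficient of [v], hence that coefficient.
   Modulo [J], the monic [h] kills [g - v], so [g] agrees with that coefficient. *)
move/(addIP _ _ iI) => [v [Jv0 Fv]].
have Fv0 : addI Z0 (prodF s) v`_0.
  have := reg_prodF_hp (monic_neq0 (monicX k)) sl s0; rewrite /alg_eval adjoinX; apply.
  move: Fv; rewrite coef0_socle => Fv.
  rewrite (_ : _ * _ = b * prodF s - (b * prodF s - v`_0 * lform l)); last by ring.
  by apply: idealB => //; apply/addI_zeroP; exists b.
have : ext (Jv vs) (g%:P - v).
  apply: (reg_ext_monic iJ (_ : h \is monic)); first by rewrite monicE lead_coefXaddC.
  rewrite (_ : _ * _ = ('X * g%:P + (b * prodF s)%:P - v * h) + (lform l * g - b * prodF s)%:P).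
    by apply: (idealD (ext_ideal iJ)) => //; apply/extC.
  by rewrite /h !(polyCB, polyCM); ring.
move/(_ 0%N); rewrite coefB (coefC g 0) => Jg.
rewrite -(subrK v`_0 g); apply: idealD; first exact: addI_ideal.
  by apply: mem_ideal_gen; left.
case/addI_zeroP: Fv0 => e ->; apply: idealM; first exact: addI_ideal.
by apply: mem_ideal_gen; right.
Qed.
End HyperplaneIdeal.

(** * Coordinates on the product *)

(* [cR] identifies [k[x,y,z][sigma][tau]] with the ring of [P^1 x P^2], where
   [sigma] is the given form [qform a b] and [tau] a complementary one. *)
Section RCoordinates.
Variable k : fieldType.

Definition kR : {rmorphism k -> RR k} := @mpolyC 5 k.
Definition inclR : {rmorphism SS k -> RR k} := comp_mpoly [tuple vR k 2; vR k 3; vR k 4].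
Definition qform (a b : k) : RR k := kR a * vR k 0 + kR b * vR k 1.

Lemma inclRC c : inclR (kC k c) = kR c.
Proof. exact: comp_mpolyC. Qed.

Lemma inclRX i : (i < 3)%N -> inclR (vS k i) = vR k i.+2.
Proof.
move=> i3; rewrite /inclR /= /vS comp_mpolyXU inordK //.
by case: i i3 => [|[|[|]]].
Qed.

Lemma eq_ext (A : comNzRingType) (I J : A -> Prop) (u : {poly A}) :
  (forall x, I x <-> J x) -> ext I u <-> ext J u.
Proof. by move=> IJ; split=> H i; apply/IJ. Qed.

Lemma RR_gen (S : RR k -> Prop) :
  (forall c, S (kR c)) -> (forall i, (i < 5)%N -> S (vR k i)) ->
  (forall f g, S f -> S g -> S (f + g)) -> (forall f g, S f -> S g -> S (f * g)) ->
  forall f, S f.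
Proof.
move=> SC SX SD SM; elim/mpolyind => [|c m f _ _ Sf].
  by have := SC 0; rewrite rmorph0.
apply: (SD) => //; rewrite -mul_mpolyC; apply: (SM); first exact: SC.
rewrite mpolyXE_id; elim/big_ind: _ => [|f1 f2|i _]; first by have := SC 1; rewrite rmorph1.
  exact: SM.
elim: (m i) => [|n IHn]; first by have := SC 1; rewrite rmorph1 expr0.
by rewrite exprS; apply: (SM) => //; rewrite -[i]inord_val; apply: SX.
Qed.

Lemma qform_span a b a' b' : a * b' - a' * b != 0 ->
  let D := (a * b' - a' * b)^-1 in
  vR k 0 = kR D * (kR b' * qform a b - kR b * qform a' b') /\
  vR k 1 = kR D * (kR a * qform a' b' - kR a' * qform a b).
Proof.
move=> D0 D.
have DD : kR D * kR (a * b' - a' * b) = 1 by rewrite -rmorphM mulVf ?rmorph1.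
split.
  rewrite -[LHS]mul1r -DD -mulrA; congr (_ * _).
  by rewrite /qform !(rmorphB kR, rmorphM kR); ring.
rewrite -[LHS]mul1r -DD -mulrA; congr (_ * _).
by rewrite /qform !(rmorphB kR, rmorphM kR); ring.
Qed.

Variables a b a' b' : k.
Hypothesis D0 : a * b' - a' * b != 0.

Definition cR : {rmorphism {poly {poly (SS k)}} -> RR k} :=
  adjoin (adjoin inclR (qform a b)) (qform a' b').

Lemma cRC f : cR f%:P%:P = inclR f.
Proof. by rewrite /cR !adjoinC. Qed.
Lemma cR0 : cR 'X%:P = qform a b.
Proof. by rewrite /cR adjoinC adjoinX. Qed.
Lemma cR1 : cR 'X = qform a' b'.
Proof. by rewrite /cR adjoinX. Qed.

Lemma cR_bij : bijective cR.
Proof.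
have [f fE] : exists f : {rmorphism k -> {poly {poly (SS k)}}}, forall x, f x = (kC k x)%:P%:P.
  by exists (polyC \o (polyC \o kC k)).
pose D := a * b' - a' * b; have DC : f D^-1 * f D = 1 by rewrite -rmorphM mulVf ?rmorph1.
pose hs : seq {poly {poly (SS k)}} :=
  [:: f D^-1 * (f b' * 'X%:P - f b * 'X); f D^-1 * (f a * 'X - f a' * 'X%:P);
      (vS k 0)%:P%:P; (vS k 1)%:P%:P; (vS k 2)%:P%:P].
have [g [gC gX]] : exists g : {rmorphism RR k -> {poly {poly (SS k)}}},
    (forall x, g (kR x) = f x) /\ (forall i, (i < 5)%N -> g (vR k i) = hs`_i).
  exists (mmap f (fun i => hs`_i)); split=> [x|i i5] /=; first by rewrite mmapC.
  by rewrite mmapX mmap1U inordK.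
have gL x y : g (qform x y) = f x * hs`_0 + f y * hs`_1.
  by rewrite /qform rmorphD !rmorphM (gC x) (gC y) !gX.
have e1 : g (cR 'X) = 'X.
  rewrite cR1 gL /hs /=; transitivity (f D^-1 * f D * 'X); last by rewrite DC mul1r.
  by rewrite /D (rmorphB f) !(rmorphM f _ b') !(rmorphM f _ b); ring.
have e0 : g (cR 'X%:P) = 'X%:P.
  rewrite cR0 gL /hs /=; transitivity (f D^-1 * f D * 'X%:P); last by rewrite DC mul1r.
  by rewrite /D (rmorphB f) !(rmorphM f _ b') !(rmorphM f _ b); ring.
have eV i : (i < 3)%N -> g (inclR (vS k i)) = (vS k i)%:P%:P.
  case: i => [|[|[|i]]] i3; last by exfalso; move: i3; rewrite !ltnS ltn0.
  - exact: etrans (congr1 g (@inclRX 0 isT)) (gX 2 isT).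
  - exact: etrans (congr1 g (@inclRX 1 isT)) (gX 3 isT).
  - exact: etrans (congr1 g (@inclRX 2 isT)) (gX 4 isT).
have eS x : g (cR x%:P%:P) = x%:P%:P.
  rewrite cRC; move: x.
  apply: (@rmorph_mpoly_eq _ _ _ (g \o inclR) (polyC \o polyC)) => [c|i].
    exact: etrans (congr1 g (inclRC c)) (etrans (gC c) (fE c)).
  by have := eV i (ltn_ord i); rewrite /vS inord_val.
exists g => [p|p].
  suff H : g \o cR =1 idfun by exact: H.
  apply: rmorph_poly_eq => [q|]; last exact: e1.
  move: q; apply: (@rmorph_poly_eq _ _ ((g \o cR) \o polyC) polyC) => [q|]; last exact: e0.
  exact: eS.
have cf x : cR (f x) = kR x by rewrite fE cRC inclRC.
have [Lx Ly] := qform_span D0.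
move: p; apply: RR_gen => [c|i i5|p q Ep Eq|p q Ep Eq].
- exact: etrans (congr1 cR (gC c)) (cf c).
- rewrite gX //; case: i i5 => [|[|[|[|[|//]]]]] _; rewrite /hs /=.
  + by rewrite rmorphM cf rmorphB 2!rmorphM !cf cR0 cR1 -Lx.
  + by rewrite rmorphM cf rmorphB 2!rmorphM !cf cR0 cR1 -Ly.
  + by rewrite cRC inclRX.
  + by rewrite cRC inclRX.
  + by rewrite cRC inclRX.
- by rewrite !rmorphD Ep Eq.
- by rewrite !rmorphM Ep Eq.
Qed.

Lemma vert_ideal_cR v w m f :
  ideal_pow (ideal_gen (fun h => h = inclR (lform v) \/ h = inclR (lform w))) m (cR f) <->
  ext (ext (ideal_pow (ideal_gen (fun h => h = lform v \/ h = lform w)) m)) f.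
Proof.
set G := ideal_gen (fun h => h = lform v \/ h = lform w).
have iG : is_ideal G by apply: ideal_gen_ideal.
have inj := bij_inj cR_bij.
apply: iff_trans (ideal_pow_iso _ _ _ cR_bij) _.
apply: (iff_trans (B := ideal_pow (ext (ext G)) m f)).
  apply: eq_ideal_pow => h; apply: iff_trans (ideal_gen_iso _ _ cR_bij) _.
  pose G1 (h : {poly SS k}) := exists2 g, g = lform v \/ g = lform w & h = g%:P.
  apply: (iff_trans (B := ext (ideal_gen G1) h)); last by apply: eq_ext => x; apply: ext_gen.
  apply: iff_trans (ext_gen _ _); apply: eq_ideal_gen => {}h; split.
    case=> E.
      by exists (lform v)%:P; [exists (lform v); [left|]|apply: inj; rewrite cRC].
    by exists (lform w)%:P; [exists (lform w); [right|]|apply: inj; rewrite cRC].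
  by move=> [h1 [h2 [] -> ->] ->]; rewrite cRC; [left|right].
apply: iff_trans (ext_pow _ _ (ext_ideal iG)) _.
by apply: eq_ext => x; apply: ext_pow.
Qed.

Lemma horiz_ideal_cR v f :
  ideal_gen (fun h => h = qform a b \/ h = inclR (lform v)) (cR f) <->
  forall i, addI (@zeroI (SS k)) (lform v) (f`_i)`_0.
Proof.
have inj := bij_inj cR_bij.
pose G1 (h : {poly SS k}) := h = 'X \/ h = (lform v)%:P.
apply: (iff_trans (B := ext (ideal_gen G1) f)).
  apply: iff_trans (ideal_gen_iso _ _ cR_bij) _.
  apply: iff_trans (ext_gen _ _); apply: eq_ideal_gen => h; split.
    case=> E.
      by exists 'X; [left|apply: inj; rewrite cR0].
    by exists (lform v)%:P; [right|apply: inj; rewrite cRC].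
  by move=> [h1 [] -> ->]; [left; rewrite cR0|right; rewrite cRC].
suff H g : ideal_gen G1 g <-> addI (@zeroI (SS k)) (lform v) g`_0.
  by split=> H1 i; apply/H; apply: H1.
split=> [/ideal_gen2P [c [d ->]]|/addI_zeroP [d Ed]].
  apply/addI_zeroP; exists d`_0; rewrite coefD coefMX coef0M add0r.
  by rewrite (coefC (lform v) 0).
apply/ideal_gen2P; exists (drop_poly 1 g), d%:P; rewrite -polyCM -Ed.
rewrite -{1}(poly_take_drop 1 g) addrC expr1; congr (_ + _).
by apply/polyP => i; rewrite coef_take_poly coefC; case: i.
Qed.

End RCoordinates.

(** * From lists of lines to coefficient vectors *)

Section LinesData.
Variable k : fieldType.
Local Notation vec := (k * k * k)%type.
Local Notation Z0 := (@zeroI (SS k)).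

Lemma lin01P (B : SS k) : lin01 B -> exists2 v, v != 0 & B = lform v.
Proof.
move=> [x [y [z [nz ->]]]]; exists (x, y, z); last by rewrite /lform /= !mul_mpolyC.
by apply/eqP => -[x0 y0 z0]; move: nz; rewrite x0 y0 z0 !eqxx; case=> [|[]].
Qed.

Lemma deg10P (A : RR k) : deg10 A -> exists x y, (x != 0) || (y != 0) /\ A = qform x y.
Proof.
move=> [x [y [nz ->]]]; exists x, y; rewrite /qform /= !mul_mpolyC; split=> //.
by case: nz => ->; rewrite ?orbT.
Qed.

Lemma cross_eq0 (v w : vec) : v != 0 -> cross v w = 0 ->
  exists c, w = (c * v.1.1, c * v.1.2, c * v.2).
Proof.
case: v => [[v0 v1] v2]; case: w => [[w0 w1] w2] vn; rewrite /cross /=.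
case=> /eqP; rewrite subr_eq0 => /eqP E1 /eqP; rewrite subr_eq0 => /eqP E2 /eqP.
rewrite subr_eq0 => /eqP E3.
have [v00|v00] := eqVneq v0 0; last first.
  exists (w0 / v0); congr ((_, _), _); first by rewrite divfK.
    by apply: (mulfI v00); rewrite E3 mulrA [v0 * _]mulrC divfK // mulrC.
  by apply: (mulfI v00); rewrite -E2 mulrA [v0 * _]mulrC divfK // mulrC.
have [v10|v10] := eqVneq v1 0; last first.
  exists (w1 / v1); congr ((_, _), _); [|by rewrite divfK|].
    move: E3; rewrite v00 mul0r mulr0 => /esym /eqP.
    by rewrite mulf_eq0 (negPf v10) => /eqP.
  by apply: (mulfI v10); rewrite E1 mulrA [v1 * _]mulrC divfK // mulrC.
have [v20|v20] := eqVneq v2 0; first by rewrite v00 v10 v20 eqxx in vn.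
exists (w2 / v2); congr ((_, _), _); last by rewrite divfK.
  move: E2; rewrite v00 mul0r mulr0 => /eqP.
  by rewrite mulf_eq0 (negPf v20) => /eqP.
move: E1; rewrite v10 mul0r mulr0 => /esym /eqP.
by rewrite mulf_eq0 (negPf v20) => /eqP.
Qed.

Lemma lformZ c (v : vec) : lform (c * v.1.1, c * v.1.2, c * v.2) = kC k c * lform v.
Proof. by rewrite /lform !(rmorphM (kC k) c); ring. Qed.

Lemma vert_okP (B B' : SS k) : line_ok (Vert B B') ->
  exists v w, [/\ cross v w != 0, B = lform v & B' = lform w].
Proof.
move=> [/lin01P [v v0 ->] /lin01P [w w0 ->] ind]; exists v, w; split=> //.
apply/eqP => /(cross_eq0 v0) [c Ew].
have [|_ /eqP] := ind c (-1); last by rewrite oppr_eq0 oner_eq0.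
by rewrite Ew lformZ scaleN1r -mul_mpolyC subrr.
Qed.

Variables a b a' b' : k.
Hypothesis D0 : a * b' - a' * b != 0.
Local Notation phi := (cR a b a' b').

Lemma horiz_okP (A : RR k) (B : SS k) : line_ok (Horiz A B) ->
  line_ideal (Horiz A B) (qform a b) -> exists v, [/\ v != 0, B = lform v &
    forall f, line_ideal (Horiz A B) f <->
      ideal_gen (fun h => h = qform a b \/ h = inclR k (lform v)) f].
Proof.
move=> [/deg10P [x [y [xy ->]]] /lin01P [v v0 ->]] H; exists v; split=> // f.
(* A common zero of [A] and [B]; evaluating there the membership of [qform a b] gives [a y = b x],
   so [A] is proportional to [qform a b]. *)
pose pt (i : 'I_5) : k := [:: y; - x; 0; 0; 0]`_i.
pose e : {rmorphism RR k -> k} := meval pt.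
have eX i : (i < 5)%N -> e (vR k i) = [:: y; - x; 0; 0; 0]`_i.
  by move=> i5; rewrite /e /= mevalXU /pt inordK.
have eC c : e (kR k c) = c by rewrite /e /= mevalC.
have eB : e (inclR k (lform v)) = 0.
  have eV i : (i < 3)%N -> e (inclR k (vS k i)) = 0.
    by move=> i3; rewrite inclRX // eX; case: i i3 => [|[|[|]]].
  have [e' Ee'] : exists e' : {rmorphism SS k -> k}, forall f, e' f = e (inclR k f).
    by exists (e \o inclR k).
  by rewrite -Ee' /lform 2!rmorphD 3!rmorphM !Ee' (eV 0%N) // (eV 1%N) // (eV 2%N) // !mulr0 !addr0.
have eq u w : e (qform u w) = u * y - w * x.
  by rewrite /qform (rmorphD e) 2!(rmorphM e) !eX // !eC /= mulrN.
have E : a * y = b * x.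
  move: H => /ideal_gen2P [p [q Epq]].
  have := congr1 e Epq; rewrite eq (rmorphD e) 2!(rmorphM e) eq -/(inclR k (lform v)) eB.
  by rewrite [x * y]mulrC subrr !mulr0 addr0 => /eqP; rewrite subr_eq0 => /eqP.
have [c [c0 Ea Eb]] : exists c, [/\ c != 0, a = c * x & b = c * y].
  have ab0 : (a != 0) || (b != 0).
    apply: contraR D0; rewrite negb_or !negbK => /andP [/eqP -> /eqP ->].
    by rewrite mul0r mulr0 subrr.
  have [c [Ea Eb]] : exists c, a = c * x /\ b = c * y.
    have [x0|x0] := eqVneq x 0.
      move: xy E; rewrite x0 eqxx /= mulr0 => y0 /eqP; rewrite mulf_eq0 (negPf y0) orbF => /eqP ->.
      by exists (b / y); rewrite mulr0 divfK.
    by exists (a / x); rewrite divfK // mulrAC E mulfK.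
  exists c; split=> //; apply: contraTneq ab0 => c0.
  by rewrite Ea Eb c0 !mul0r eqxx.
have Eq : qform a b = kR k c * qform x y.
  by rewrite /qform Ea Eb !(rmorphM (kR k) c); ring.
have Eq' : qform x y = kR k c^-1 * qform a b.
  by rewrite Eq mulrA -rmorphM mulVf // rmorph1 mul1r.
split; move: f; apply: ideal_genS => h [] ->.
- rewrite Eq'; apply: idealM; first exact: ideal_gen_ideal.
  by apply: mem_ideal_gen; left.
- by apply: mem_ideal_gen; right.
- rewrite Eq; apply: idealM; first exact: ideal_gen_ideal.
  by apply: mem_ideal_gen; left.
- by apply: mem_ideal_gen; right.
Qed.

Lemma horiz_ideal_parallel (v w : vec) f : v != 0 -> w != 0 -> cross v w = 0 ->
  ideal_gen (fun h => h = qform a b \/ h = inclR k (lform v)) f <->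
  ideal_gen (fun h => h = qform a b \/ h = inclR k (lform w)) f.
Proof.
move=> v0 w0 /(cross_eq0 v0) [c Ew].
have c0 : c != 0.
  by apply: contraNneq w0 => c0; rewrite Ew c0 !mul0r.
have E : lform w = kC k c * lform v by rewrite Ew lformZ.
have E' : lform v = kC k c^-1 * lform w.
  by rewrite E mulrA -rmorphM mulVf // rmorph1 mul1r.
split; move: f; apply: ideal_genS => h [] ->; try by apply: mem_ideal_gen; left.
  rewrite E' (rmorphM (inclR k)); apply: idealM; first exact: ideal_gen_ideal.
  by apply: mem_ideal_gen; right.
rewrite E (rmorphM (inclR k)); apply: idealM; first exact: ideal_gen_ideal.
by apply: mem_ideal_gen; right.
Qed.

Lemma Jv_consP p vs (g : SS k) : Jv (p :: vs) g <->
  ideal_pow (ideal_gen (fun h => h = lform p.1.1 \/ h = lform p.1.2)) p.2 g /\ Jv vs g.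
Proof.
split=> [H|[Hp H] q]; first by split=> [|q qv]; apply: H; rewrite inE ?eqxx ?qv ?orbT.
by rewrite inE => /orP [/eqP ->|/H].
Qed.

Lemma fat_ideal_consP (p : line k * nat) Z f :
  fat_ideal (p :: Z) f <-> ideal_pow (line_ideal p.1) p.2 f /\ fat_ideal Z f.
Proof.
split=> [H|[Hp H] q [<-|/H]] //.
by split=> [|q qZ]; apply: H; [left|right].
Qed.

(** The last clause remembers which entry of [Z] a vector of [s] comes from; when a line is added,
    distinctness of the lines then yields [cross v w != 0]. *)
Definition lines_data (Z : seq (line k * nat)) vs (s : seq vec) :=
  [/\ [/\ forall p, p \in vs -> cross p.1.1 p.1.2 != 0, forall v, v \in s -> v != 0 &
          pairwise (fun v w => cross v w != 0) s],
      horizF Z = prodF s /\ size s = size (Z1 Z),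
      forall f, fat_ideal (Z2 Z) (phi f) <-> ext (ext (Jv vs)) f,
      forall f, fat_ideal Z (phi f) <-> ext (ext (Jv vs)) f /\
        (forall v, v \in s -> forall i, addI Z0 (lform v) (f`_i)`_0) &
      forall v, v \in s -> exists2 i, (i < size Z)%N &
        forall f, line_ideal (nth (Vert 0 0, 0%N) Z i).1 f <->
          ideal_gen (fun h => h = qform a b \/ h = inclR k (lform v)) f].

Lemma lines_data_exists Z :
  fat_lines_ok Z -> (forall p, List.In p (Z1 Z) -> p.2 = 1%N) ->
  (forall p, List.In p (Z1 Z) -> line_ideal p.1 (qform a b)) ->
  exists vs s, lines_data Z vs s.
Proof.
elim: Z => [|[L n] Z IHZ] [okZ distZ] redZ hypZ.
  exists [::], [::]; split.
  - by split.
  - by split=> //; rewrite /horizF /prodF !big_nil.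
  - by move=> f; split=> [_ i j|_ p []].
  - by move=> f; split=> [_|_ p []]; split=> // i j.
  - by [].
have [|p pZ|p pZ|vs [s [[cv sv ps] [Fs ss] J2 JZ sZ]]] := IHZ.
- split=> [p pZ|i j iZ jZ ij]; first by apply: okZ; right.
  by apply: (distZ i.+1 j.+1) => // -[].
- by apply: redZ; rewrite /Z1 /=; case: ifP => _; [right|].
- by apply: hypZ; rewrite /Z1 /=; case: ifP => _; [right|].
have [okL _] := okZ (L, n) (or_introl erefl).
case: L okL okZ distZ redZ hypZ => [A B|B B'] okL okZ distZ redZ hypZ.
  have n1 : n = 1%N := redZ (Horiz A B, n) (or_introl erefl).
  have [v [v0 EB Ev]] := horiz_okP okL (hypZ (Horiz A B, n) (or_introl erefl)).
  exists vs, (v :: s); split.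
  - split=> // [w|]; first by rewrite inE => /orP [/eqP ->|/sv].
    rewrite /= ps andbT; apply/allP => w ws; apply/eqP => vw.
    have [i iZ Ei] := sZ w ws; apply: (distZ 0%N i.+1) => // f /=.
    apply: iff_trans (Ev f) _; apply: iff_trans (iff_sym (Ei f)).
    exact: horiz_ideal_parallel (sv w ws) vw.
  - split; last by rewrite /Z1 /= -/(Z1 Z) ss.
    by rewrite /horizF /prodF !big_cons /= -/(horizF Z) Fs EB.
  - exact: J2.
  - move=> f; apply: iff_trans (fat_ideal_consP _ _ _) _.
    have -> : n = 1%N := n1.
    have Hv : ideal_pow (line_ideal (Horiz A B)) 1 (phi f) <->
        forall i, addI Z0 (lform v) (f`_i)`_0.
      apply: iff_trans (ideal_pow1 _ _) _; first exact: ideal_gen_ideal.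
      by apply: iff_trans (Ev _) (horiz_ideal_cR D0 _ _).
    split=> [[/Hv fv /JZ [Jf Hs]]|[Jf Hs]].
      by split=> // w; rewrite inE => /orP [/eqP ->|/Hs].
    split; first by apply/Hv/Hs; rewrite mem_head.
    by apply/JZ; split=> // w ws; apply: Hs; rewrite inE ws orbT.
  - move=> w; rewrite inE => /orP [/eqP ->|/sZ [i iZ Ei]]; last by exists i.+1.
    by exists 0%N.
have [v [w [vw EB EB']]] := vert_okP okL.
have Hp f : ideal_pow (line_ideal (Vert B B')) n (phi f) <->
    ext (ext (ideal_pow (ideal_gen (fun h => h = lform v \/ h = lform w)) n)) f.
  by rewrite EB EB'; apply: (vert_ideal_cR D0).
have HJ f : ext (ext (Jv ((v, w, n) :: vs))) f <->
    ext (ext (ideal_pow (ideal_gen (fun h => h = lform v \/ h = lform w)) n)) f /\ ext (ext (Jv vs)) f.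
  split=> [H|[H1 H2] i j]; last by apply/Jv_consP; split; [apply: H1|apply: H2].
  by split=> i j; have /Jv_consP [] := H i j.
exists ((v, w, n) :: vs), s; split.
- by split=> // p; rewrite inE => /orP [/eqP ->|/cv].
- by split=> //; rewrite /horizF big_cons mul1r.
- move=> f; apply: iff_trans (fat_ideal_consP _ _ _) _; rewrite HJ.
  by split=> -[/Hp ? /J2 ?].
- move=> f; apply: iff_trans (fat_ideal_consP _ _ _) _; rewrite HJ.
  by split=> [[/Hp ? /JZ []]|[[/Hp ? ?] ?]] //; split=> //; apply/JZ.
- by move=> x /sZ [i iZ Ei]; exists i.+1.
Qed.
End LinesData.

(** * Depth, dimension and the theorem *)

Section DepthAndDimension.
Variable k : fieldType.
Hypothesis char0 : [pchar k] =i pred0.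
Local Notation vec := (k * k * k)%type.
Local Notation Z0 := (@zeroI (SS k)).

Lemma ideal_add_seq1_addI (T : comNzRingType) (I : T -> Prop) f g : is_ideal I ->
  ideal_add_seq I [:: f] g <-> addI I f g.
Proof.
by move=> iI; apply: iff_trans (ideal_add_seq1P iI _ _) (iff_sym (addIP _ _ iI)).
Qed.

Lemma addI2P (T : comNzRingType) (I : T -> Prop) f f' g : is_ideal I ->
  addI (addI I f) f' g <-> exists r r', I (g - r * f - r' * f').
Proof.
move=> iI; apply: iff_trans (addIP _ _ (addI_ideal _ _)) _.
split=> [[d /(addIP _ _ iI) [e Ie]]|[r [r' Ir]]].
  by exists e, d; rewrite (_ : _ - _ = g - d * f' - e * f) //; ring.
exists r'; apply/(addIP _ _ iI); exists r.
by rewrite (_ : _ - _ = g - r * f - r' * f') //; ring.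
Qed.

Lemma ideal_add_seq2_addI (T : comNzRingType) (I : T -> Prop) f f' g : is_ideal I ->
  ideal_add_seq I [:: f; f'] g <-> addI (addI I f) f' g.
Proof.
by move=> iI; apply: iff_trans (ideal_add_seq2P iI _ _ _) (iff_sym (addI2P _ _ _ iI)).
Qed.

Lemma ideal_iso (U T : comNzRingType) (f : {rmorphism U -> T}) (I : T -> Prop) (K : U -> Prop) :
  bijective f -> (forall u, I (f u) <-> K u) -> is_ideal K -> is_ideal I.
Proof.
move=> [g fK gK] IK iK; split=> [|x y Ix Iy|r x Ix].
- by rewrite -(rmorph0 f); apply/IK; apply: (ideal0 iK).
- rewrite -[x]gK -[y]gK -rmorphD; apply/IK; apply: (idealD iK); apply/IK; by rewrite gK.
- rewrite -[r]gK -[x]gK -rmorphM; apply/IK; apply: (idealM _ iK); apply/IK; by rewrite gK.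
Qed.

(** If the power [n.+1] of [I] multiplies [f] into [H], the power [n] does so for each [x * f] with
    [x] in [I]; so one factor is enough. *)
Lemma saturated_of_socle (I H : SS k -> Prop) : is_ideal H ->
  (forall g, (forall x, I x -> H (x * g)) -> H g) -> saturated_wrt I H.
Proof.
move=> iH soc f [n]; elim: n f => [|n IHn] f Hf.
  by rewrite -[f]mulr1; apply: Hf; apply: ideal_pow0.
apply: soc => x Ix; apply: IHn => r Ir; rewrite mulrAC mulrC; apply: Hf.
by apply: mem_ideal_gen; exists x, r.
Qed.

Section Coordinates.
Variables a b a' b' : k.
Hypothesis D0 : a * b' - a' * b != 0.
Local Notation phi := (cR a b a' b').

Variables (I : RR k -> Prop) (vs : seq (vec * vec * nat)) (s : seq vec).
Hypotheses (HI : forall f, I (phi f) <-> ext (planeI vs s) f)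
  (vs0 : forall p, p \in vs -> cross p.1.1 p.1.2 != 0)
  (sv : forall v, v \in s -> v != 0) (s0 : s != [::]).

Let iP := planeI_ideal vs s.
Let iI : is_ideal I.
Proof. exact: (ideal_iso (cR_bij D0) HI (ext_ideal iP)). Qed.
Let sur t : exists u, phi u = t.
Proof. by have [g _ gK] := cR_bij D0; exists (g t). Qed.

Let addI_ext x u : addI I (phi x%:P) (phi u) <-> ext (addI (planeI vs s) x) u.
Proof.
apply: iff_trans (iff_sym (addI_iso _ _ _ (cR_bij D0))) _.
by apply: iff_trans (eq_addI _ _ HI) _; apply: ext_addI.
Qed.

Let addI2_ext x y u : addI (addI I (phi x%:P)) (phi y%:P) (phi u) <->
  ext (addI (addI (planeI vs s) x) y) u.
Proof.
apply: iff_trans (iff_sym (addI_iso _ _ _ (cR_bij D0))) _.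
apply: iff_trans (eq_addI _ _ (addI_ext x)) _.
by apply: ext_addI; apply: addI_ideal.
Qed.

Lemma RR_algebraic (m : RR k -> Prop) x : maximal_ideal m ->
  exists q : {poly k}, q \is monic /\ m (adjoin (kR k) x q).
Proof.
move=> mm; apply: (maximal_ideal_algebraic mm (f := kR k) (xs := [seq vR k i | i <- iota 0 5])).
move=> S SC SX SD SM; apply: RR_gen => // i i5; apply: SX.
by apply: map_f; rewrite mem_iota.
Qed.

Lemma depth_ge_saturated (m : RR k -> Prop) : maximal_ideal m -> ideal_sub I m ->
  saturated_wrt (@irrS k) (addI (Jv vs) (prodF s)) -> depth_ge I m 3.
Proof.
move=> mm Im sat; have pm := maximal_ideal_prime mm.
have [l [l' [vl sl]]] := generic_pair char0 vs0 sv.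
have [q1 [mq1 m1]] := RR_algebraic (inclR k (lform l)) mm.
have [q2 [mq2 m2]] := RR_algebraic (qform a b + inclR k (lform l')) mm.
have [q3 [mq3 m3]] := RR_algebraic (qform a' b') mm.
pose u1 : {poly SS k} := (alg_eval q1 (lform l))%:P.
pose u2 := adjoin (polyC \o kC k) ('X + (lform l')%:P) q2.
pose iota : {rmorphism k -> {poly SS k}} := polyC \o kC k.
pose u3 := map_poly iota q3.
have E1 : phi u1%:P = adjoin (kR k) (inclR k (lform l)) q1.
  rewrite cRC /alg_eval; move: {m1 mq1 u1} q1.
  apply: (@rmorph_poly_eq _ _ (inclR k \o adjoin (kC k) (lform l)) (adjoin _ _)) => [c|].
    by rewrite /= !adjoinC inclRC.
  by rewrite /= !adjoinX.
have E2 : phi u2%:P = adjoin (kR k) (qform a b + inclR k (lform l')) q2.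
  rewrite /u2; move: {m2 mq2 u2} q2.
  apply: (@rmorph_poly_eq _ _ ((phi \o polyC) \o adjoin (polyC \o kC k) ('X + (lform l')%:P)) (adjoin _ _)) => [c|].
    by rewrite /= !adjoinC /= ?cRC inclRC.
  by rewrite /= !adjoinX (polyCD 'X) (rmorphD phi) cR0 (cRC _ _ _ _ (lform l')).
have E3 : phi u3 = adjoin (kR k) (qform a' b') q3.
  rewrite /u3; move: {m3 mq3 u3} q3.
  apply: (@rmorph_poly_eq _ _ (phi \o map_poly iota) (adjoin _ _)) => [c|].
    by rewrite /= map_polyC /= !adjoinC /= ?adjoinC inclRC.
  by rewrite /= map_polyX !adjoinX.
rewrite -E1 in m1; rewrite -E2 in m2; rewrite -E3 in m3.
(* The first two elements do not involve [tau] and are treated in [k[x,y,z][sigma]]; the third is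
   monic in [tau], hence regular modulo any ideal extended from there. *)
apply: (depth_ge3 iI pm Im m1 m2 m3).
- apply: (reg_iso sur); apply: (eq_reg (fun f => iff_sym (HI f))); apply: reg_extC.
  exact: (reg_planeI_hp vl sl s0 mq1).
- apply: (eq_reg (fun f => iff_sym (ideal_add_seq1_addI _ f iI))).
  apply: (reg_iso sur); apply: (eq_reg (fun f => iff_sym (addI_ext u1 f))); apply: reg_extC.
  exact: (reg_planeI_shift vl sl s0 mq1 mq2 sat).
- apply: (eq_reg (fun f => iff_sym (ideal_add_seq2_addI _ _ f iI))).
  apply: (reg_iso sur); apply: (eq_reg (fun f => iff_sym (addI2_ext u1 u2 f))).
  by apply: reg_ext_monic; [apply: addI_ideal|rewrite map_monic].
Qed.

Let eps : {rmorphism RR k -> k} := meval (fun _ => 0).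
Definition origin (f : RR k) := meval (fun _ => 0) f = 0.

Lemma epsC c : eps (kR k c) = c. Proof. by rewrite /eps /= mevalC. Qed.
Lemma epsX i : eps (vR k i) = 0. Proof. by rewrite /eps /= mevalXU. Qed.
Lemma eps_qform x y : eps (qform x y) = 0.
Proof. by rewrite /qform (rmorphD eps) 2!(rmorphM eps) !epsX !mulr0 addr0. Qed.
Lemma eps_lform v : eps (inclR k (lform v)) = 0.
Proof.
have [e Ee] : exists e : {rmorphism SS k -> k}, forall f, e f = eps (inclR k f).
  by exists (eps \o inclR k).
have eV i : (i < 3)%N -> e (vS k i) = 0 by move=> i3; rewrite Ee inclRX // epsX.
by rewrite -Ee /lform 2!(rmorphD e) 3!(rmorphM e) (eV 0%N) // (eV 1%N) // (eV 2%N) // !mulr0 !addr0.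
Qed.

Lemma origin_maximal : maximal_ideal origin.
Proof.
have io : is_ideal origin.
  split=> [|f g|r f]; rewrite /origin ?mevalD ?mevalM ?meval0 //.
    by move=> -> ->; rewrite addr0.
  by move=> ->; rewrite mulr0.
split=> //; first by rewrite /origin meval1 => /eqP; rewrite oner_eq0.
move=> J iJ oJ; have [|no] := boolp.EM (ideal_sub J origin); first by left.
right; have [f [Jf of0]] : exists f, J f /\ eps f != 0.
  apply: boolp.contrapT => no'; apply: no => f Jf; apply/eqP/negPn/negP => of0.
  by apply: no'; exists f.
have Jc : J (kR k (eps f)).
  rewrite (_ : kR k _ = f - (f - kR k (eps f))); last by rewrite opprB addrCA subrr addr0.
  apply: idealB => //; apply: oJ.
  by rewrite /origin -/(eps _) rmorphB epsC subrr.
rewrite -(rmorph1 (kR k)) -(mulVf of0) rmorphM; exact: idealM.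
Qed.

Lemma saturated_of_depth : depth_ge I origin 3 ->
  saturated_wrt (@irrS k) (addI (Jv vs) (prodF s)).
Proof.
move=> dep; have pm := maximal_ideal_prime origin_maximal.
apply: saturated_of_socle => [|g soc]; first exact: addI_ideal.
have [l [l' [_ sl]]] := generic_pair char0 vs0 sv.
have irl : irrS (lform l).
  rewrite /lform; have iS : is_ideal (@irrS k) by apply: ideal_gen_ideal.
  by apply: idealD => //; [apply: idealD => //|]; apply: idealM => //; apply: mem_ideal_gen; auto.
have [u0 [Ks Kx Kend]] := socle_planeI sl s0 soc irl.
set h := 'X + _ in Ks Kx Kend; set P := planeI vs s in Ks Kx Kend.
have mh : h \is monic by rewrite monicE lead_coefXaddC.
pose h1 := phi h%:P; pose h2 := phi 'X; pose u := phi u0%:P.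
have reg1 : reg I h1.
  apply: (reg_iso sur); apply: (eq_reg (fun f => iff_sym (HI f))); apply: reg_extC.
  exact: (reg_planeI_linear sl s0).
have reg2 : reg (addI I h1) h2.
  apply: (reg_iso sur); apply: (eq_reg (fun f => iff_sym (addI_ext h f))).
  by apply: reg_ext_monic; [apply: addI_ideal|apply: monicX].
pose K := addI (addI I h1) h2; have iK : is_ideal K by apply: addI_ideal.
have KP f : addI P h f -> K (phi f%:P).
  move=> Pf; apply: mem_ideal_gen; left; apply/addI_ext.
  by apply/extC => //; apply: addI_ideal.
have K0 : K (qform a b * u) by rewrite -(cR0 a b a' b') -rmorphM -polyCM; apply: KP.
have K1 : K (qform a' b' * u).
  by rewrite -(cR1 a b a' b') mulrC; apply: (idealM _ iK); apply: mem_ideal_gen; right.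
have KZ c f : K (f * u) -> K (kR k c * f * u) by rewrite -mulrA; apply: idealM.
have KV i : (i < 5)%N -> K (vR k i * u).
  have [Lx Ly] := qform_span D0.
  have KS j : (j < 3)%N -> irrS (vS k j) -> K (vR k j.+2 * u).
    by move=> j3 irj; rewrite -inclRX // -(cRC a b a' b') -rmorphM -polyCM; apply: KP; apply: Kx.
  case: i => [|[|[|[|[|i]]]]] // _.
  - by rewrite Lx -mulrA mulrBl; apply: (idealM _ iK); apply: idealB => //; apply: KZ.
  - by rewrite Ly -mulrA mulrBl; apply: (idealM _ iK); apply: idealB => //; apply: KZ.
  - by apply: (KS 0%N) => //; apply: mem_ideal_gen; auto.
  - by apply: (KS 1%N) => //; apply: mem_ideal_gen; auto.
  - by apply: (KS 2%N) => //; apply: mem_ideal_gen; auto.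
(* Every polynomial acts on [u] modulo [K] through its value at the origin, because the variables
   kill [u]. *)
have Ksub f : K ((f - kR k (eps f)) * u).
  move: f; apply: RR_gen => [c|i i5|f f' Kf Kf'|f f' Kf Kf'].
  - by rewrite epsC subrr mul0r; apply: ideal0.
  - by rewrite epsX rmorph0 subr0; apply: KV.
  - rewrite rmorphD rmorphD (_ : _ * u = (f - kR k (eps f)) * u + (f' - kR k (eps f')) * u).
      exact: idealD.
    by ring.
  - rewrite rmorphM rmorphM.
    rewrite (_ : _ * u = f * ((f' - kR k (eps f')) * u) + kR k (eps f') * ((f - kR k (eps f)) * u)).
      by apply: idealD => //; apply: idealM.
    by ring.
have reg2' f r : I (h2 * f - r * h1) -> exists r', I (f - r' * h1).
  by move=> Ir; apply/(addIP _ _ iI)/reg2/(addIP _ _ iI); exists r.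
have [r r0|w [c [d [ow Iw]]]] := socle_exchange (u := u) iI pm reg1 reg2' dep.
  apply/(addI2P _ _ _ iI); rewrite -/K.
  by have := Ksub r; rewrite (_ : eps r = 0) // rmorph0 subr0.
have Kw : K (w * u) by apply/(addI2P _ _ _ iI); exists c, d.
(* The denominator [w] thus acts as a non-zero scalar, so local vanishing of [u] is vanishing modulo
   [K] itself. *)
have ew0 : eps w != 0 by apply/eqP.
have Ku : K u.
  rewrite -[u]mul1r -(rmorph1 (kR k)) -(mulVf ew0) rmorphM -mulrA; apply: (idealM _ iK).
  rewrite (_ : _ * u = w * u - (w - kR k (eps w)) * u); last by ring.
  exact: idealB.
apply: Kend; move: Ku; rewrite /K /h2 => /(addI_iso _ _ _ (cR_bij D0)).
move/(eq_addI _ _ (addI_ext h))/(addIP _ _ (ext_ideal (addI_ideal _ _))) => [e] /(_ 0%N).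
by rewrite coefB coefMX (coefC u0 0) subr0.
Qed.
End Coordinates.
End DepthAndDimension.

(** * Upper bound on the dimension *)

Section FatLinesDimension.
Variable k : fieldType.
Local Notation vec := (k * k * k)%type.

Lemma prime_fat_ideal (Z : seq (line k * nat)) Q : prime_ideal Q -> ideal_sub (fat_ideal Z) Q ->
  exists2 p, List.In p Z & ideal_sub (line_ideal p.1) Q.
Proof.
move=> prQ ZQ; have [iQ Q1 QM] := prQ; apply: boolp.contrapT => no.
suff [x Zx Qx] : exists2 x, fat_ideal Z x & ~ Q x by apply: Qx; apply: ZQ.
elim: Z no {ZQ} => [|[L n] Z IHZ] no; first by exists 1 => // p [].
have [[p pZ pQ]|x Zx Qx] := IHZ.
  by apply: no; exists p => //; right.
have [y [Ly Qy]] : exists y, line_ideal L y /\ ~ Q y.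
  apply: boolp.contrapT => no'; apply: no; exists (L, n); first by left.
  by move=> y Ly; apply: boolp.contrapT => Qy; apply: no'; exists y.
have Ln : ideal_pow (line_ideal L) n (y ^+ n).
  elim: (n) => [|j IHj]; first exact: ideal_pow0.
  by apply: mem_ideal_gen; exists y, (y ^+ j); rewrite exprS.
exists (y ^+ n * x).
  apply/fat_ideal_consP; split; first exact: (idealMr _ (ideal_pow_ideal _ _)).
  by move=> p pZ; apply: (idealM _ (ideal_pow_ideal _ _)); apply: Zx.
by move/QM => [/(prime_idealX prQ)|].
Qed.

Lemma complement_qform (x y : k) : (x != 0) || (y != 0) ->
  exists x' y', x * y' - x' * y != 0.
Proof.
have [-> /= y0|x0 _] := eqVneq x 0; first by exists 1, 0; rewrite mulr0 mul1r sub0r oppr_eq0.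
by exists 0, 1; rewrite mulr1 mul0r subr0.
Qed.

Hypothesis char0 : [pchar k] =i pred0.

Lemma complement_cross (n : vec) : n != 0 -> exists c, dot n c != 0.
Proof.
move=> n0; have [|t /(_ n (mem_head _ _)) Ht] := generic_moment char0 (ns := [:: n]).
  by move=> x; rewrite inE => /eqP ->.
by exists (moment t).
Qed.

Lemma complement_lform (v : vec) : v != 0 -> exists w c, dot (cross v w) c != 0.
Proof.
move=> v0; have [e ev] := cross_neq0 v0.
have [c Hc] := complement_cross ev; exists c, e.
move: Hc; congr (_ != _); rewrite /dot /cross /=; ring.
Qed.

Section Generated.
Variables (Q : RR k -> Prop) (y : seq (RR k)).
Hypothesis iQ : is_ideal Q.

Let ev : {rmorphism {mpoly k[3]} -> RR k} := mmap (kR k) (fun i : 'I_3 => y`_i).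
Let G t := exists p, Q (t - ev p).

Lemma generated_modulo : 
  (forall i, (i < 3)%N -> G y`_i) /\ (forall t, Q t -> G t) /\
  (forall c, G (kR k c)) /\ (forall f g, G f -> G g -> G (f + g)) /\
  (forall f g, G f -> G g -> G (f * g)) /\ (forall f g, G f -> G g -> G (f - g)).
Proof.
do !split.
- move=> i i3; exists 'X_(inord i); rewrite /ev /= mmapX mmap1U inordK // subrr.
  exact: ideal0.
- by move=> t Qt; exists 0; rewrite rmorph0 subr0.
- by move=> c; exists c%:MP; rewrite /ev /= mmapC subrr; apply: ideal0.
- move=> f g [p Qp] [q Qq]; exists (p + q).
  rewrite (rmorphD ev) (_ : _ - _ = (f - ev p) + (g - ev q)); first exact: idealD.
  by move: (ev p) (ev q) => x z; ring.
- move=> f g [p Qp] [q Qq]; exists (p * q).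
  rewrite (rmorphM ev) (_ : _ - _ = f * (g - ev q) + ev q * (f - ev p)); last first.
    by move: (ev p) (ev q) => x z; ring.
  by apply: idealD => //; apply: idealM.
- move=> f g [p Qp] [q Qq]; exists (p - q).
  rewrite (rmorphB ev) (_ : _ - _ = (f - ev p) - (g - ev q)); first exact: idealB.
  by move: (ev p) (ev q) => x z; ring.
Qed.
End Generated.

(** A prime over the fat ideal contains the two forms of some line; three complementary forms then
    generate [R] modulo that prime. *)
Lemma dim_fat_ideal_le (Z : seq (line k * nat)) m n :
  (forall p, List.In p Z -> line_ok p.1) -> dim_ge (fat_ideal Z) m n -> (n <= 3)%N.
Proof.
move=> okZ; apply: (dim_ge_le (f := kR k)) => Q pQ /(prime_fat_ideal pQ) [[L j] /okZ /= okL LQ].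
have iQ := prime_ideal_ideal pQ.
suff [y Hy] : exists y : seq (RR k), forall t, exists p, Q (t - mmap (kR k) (fun i : 'I_3 => y`_i) p).
  by exists (fun i : 'I_3 => y`_i).
case: L okL LQ => [A B|B B'] okL LQ.
  have [/deg10P [x [y [xy EA]]] /lin01P [v v0 EB]] := okL.
  have [x' [y' D0]] := complement_qform xy; have [w [c Hc]] := complement_lform v0.
  exists [:: qform x' y'; inclR k (lform w); inclR k (lform c)].
  have [Gy [GQ [GC [GD [GM GN]]]]] := generated_modulo [:: qform x' y'; inclR k (lform w); inclR k (lform c)] iQ.
  apply: RR_gen => //.
  have GA := GQ A (LQ A (mem_ideal_gen (or_introl erefl))); rewrite EA in GA.
  have GB := GQ (inclR k B) (LQ (inclR k B) (mem_ideal_gen (or_intror erefl))); rewrite EB in GB.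
  have [Lx Ly] := qform_span D0.
  have GS i : (i < 3)%N -> exists p, Q (vR k i.+2 -
      mmap (kR k) (fun i : 'I_3 => [:: qform x' y'; inclR k (lform w); inclR k (lform c)]`_i) p).
    move=> i3; have [r [s [t E]]] := vS_span Hc i3.
    rewrite -inclRX // E 2!(rmorphD (inclR k)) 3!(rmorphM (inclR k)) 3!inclRC.
    apply: (GD); [apply: (GD)|]; apply: (GM); try exact: GC; [exact: GB|exact: (Gy 1%N isT)|exact: (Gy 2%N isT)].
  case=> [|[|[|[|[|i]]]]] // _.
  - by rewrite Lx; apply: (GM) => //; apply: (GN); apply: (GM) => //; exact: (Gy 0%N isT).
  - by rewrite Ly; apply: (GM) => //; apply: (GN); apply: (GM) => //; exact: (Gy 0%N isT).
  - exact: (GS 0%N isT).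
  - exact: (GS 1%N isT).
  - exact: (GS 2%N isT).
have [v [w [vw EB EB']]] := vert_okP okL; have [c Hc] := complement_cross vw.
exists [:: vR k 0; vR k 1; inclR k (lform c)].
have [Gy [GQ [GC [GD [GM GN]]]]] := generated_modulo [:: vR k 0; vR k 1; inclR k (lform c)] iQ.
apply: RR_gen => //.
have GB := GQ (inclR k B) (LQ (inclR k B) (mem_ideal_gen (or_introl erefl))); rewrite EB in GB.
have GB' := GQ (inclR k B') (LQ (inclR k B') (mem_ideal_gen (or_intror erefl))); rewrite EB' in GB'.
have GS i : (i < 3)%N -> exists p, Q (vR k i.+2 -
    mmap (kR k) (fun i : 'I_3 => [:: vR k 0; vR k 1; inclR k (lform c)]`_i) p).
  move=> i3; have [r [s [t E]]] := vS_span Hc i3.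
  rewrite -inclRX // E 2!(rmorphD (inclR k)) 3!(rmorphM (inclR k)) 3!inclRC.
  apply: (GD); [apply: (GD)|]; apply: (GM); try exact: GC; [exact: GB|exact: GB'|exact: (Gy 2%N isT)].
case=> [|[|[|[|[|i]]]]] // _.
- exact: (Gy 0%N isT).
- exact: (Gy 1%N isT).
- exact: (GS 0%N isT).
- exact: (GS 1%N isT).
- exact: (GS 2%N isT).
Qed.
End FatLinesDimension.

Lemma eq_saturated (T : comNzRingType) (mm I J : T -> Prop) :
  (forall f, I f <-> J f) -> saturated_wrt mm I -> saturated_wrt mm J.
Proof.
move=> IJ sat f [n Hn]; apply/IJ; apply: sat; exists n => g /Hn.
by move/IJ.
Qed.

Lemma origin_planeI (k : fieldType) (a b a' b' : k) vs s f : s != [::] ->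
  ext (planeI vs s) f -> origin (cR a b a' b' f).
Proof.
move=> s0; have io : is_ideal (@origin k) := prime_ideal_ideal (maximal_ideal_prime (origin_maximal k)).
have [e Ee] : exists e : {rmorphism {poly {poly SS k}} -> k},
    forall u, e u = meval (fun _ => 0) (cR a b a' b' u).
  by exists (meval (fun _ => 0) \o cR a b a' b').
have iK : is_ideal (fun u => e u = 0).
  split=> [|x y Ex Ey|r x Ex]; first by rewrite rmorph0.
    by rewrite rmorphD Ex Ey addr0.
  by rewrite rmorphM Ex mulr0.
rewrite /origin -Ee; move: f; apply: (ext_min iK) => g [_ /addI_zeroP [d Ed]].
have -> : g = drop_poly 1 g * 'X + (d * prodF s)%:P.
  rewrite -Ed -{1}(poly_take_drop 1 g) addrC expr1; congr (_ + _).
  by apply/polyP => i; rewrite coef_take_poly coefC; case: i.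
have eX : e 'X%:P = 0 by rewrite Ee cR0; apply: eps_qform.
have eL v : e (lform v)%:P%:P = 0.
  exact: etrans (Ee _) (etrans (congr1 _ (cRC _ _ _ _ _)) (eps_lform v)).
have eM (x y : SS k) : e (x * y)%:P%:P = e x%:P%:P * e y%:P%:P by rewrite 2!polyCM rmorphM.
have eF : e (prodF s)%:P%:P = 0.
  case: s s0 {Ed} => [//|v s _].
  have -> : prodF (v :: s) = lform v * prodF s by apply: big_cons.
  apply: etrans (eM (lform v) (prodF s)) _.
  apply: etrans (congr1 (fun z => z * e (prodF s)%:P%:P) (eL v)) _.
  exact: mul0r.
have eDX (p : {poly SS k}) c : e (p * 'X + c%:P)%:P = e p%:P * e 'X%:P + e c%:P%:P.
  by rewrite polyCD polyCM rmorphD rmorphM.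
apply: etrans (eDX _ _) _; rewrite eX mulr0 add0r.
apply: etrans (eM d (prodF s)) _.
apply: etrans (congr1 (fun z => e d%:P%:P * z) eF) _.
exact: mulr0.
Qed.

Unset Implicit Arguments.

Theorem theorem4p5 (k : fieldType) (chark0 : [pchar k] =i pred0)
  (Z : seq (line k * nat)) :
  fat_lines_ok Z ->
  (* (a) Z_1 non-empty and reduced *)
  Z1 Z <> [::] ->
  (forall p, List.In p (Z1 Z) -> p.2 = 1%N) ->
  (* (b) *)
  (forall p p' A B A' B', List.In p Z -> List.In p' Z ->
     p.1 = Horiz A B -> p'.1 = Horiz A' B' ->
     ideal_eq (ideal_gen (fun h => h = B)) (ideal_gen (fun h => h = B')) ->
     ideal_eq (ideal_gen (fun h => h = A)) (ideal_gen (fun h => h = A'))) ->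
  (* all horizontal lines lie in one hyperplane V(A0) *)
  (exists A0, deg10 A0 /\
     forall p, List.In p (Z1 Z) -> line_ideal p.1 A0) ->
  ACM Z <->
  saturated_wrt (@irrS k)
    (ideal_gen (fun h => IZ2_S Z h \/ h = horizF Z)).
Proof.
move=> okZ Z1n redZ _ [A0 [/deg10P [a [b [ab ->]]] hypZ]].
have [a' [b' D0]] := complement_qform ab.
have [vs [s [[cv sv ps] [EF ss] EJ EZ _]]] := lines_data_exists D0 okZ redZ hypZ.
have s0 : s != [::].
  by apply/eqP => s0; apply: Z1n; apply: size0nil; rewrite -ss s0.
have HI f : fat_ideal Z (cR a b a' b' f) <-> ext (planeI vs s) f.
  apply: iff_trans (EZ f) _; split=> [[J V] i|H].
    by split; [apply: J|apply/(prodF_dvd _ ps chark0) => v vs'; apply: V].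
  split=> [i j|v v_s i]; first by have [] := H i.
  by have [_ /(prodF_dvd _ ps chark0)] := H i; apply.
have HJ g : IZ2_S Z g <-> Jv vs g.
  rewrite /IZ2_S -[incl g]/(inclR k g) -(cRC a b a' b'); apply: iff_trans (EJ _) _.
  have iJ := Jv_ideal vs.
  by apply: iff_trans (extC _ (ext_ideal iJ)) (extC _ iJ).
have iI : is_ideal (fat_ideal Z).
  exact: (ideal_iso (cR_bij D0) HI (ext_ideal (planeI_ideal vs s))).
have satE f : addI (Jv vs) (prodF s) f <->
    ideal_gen (fun h => IZ2_S Z h \/ h = horizF Z) f.
  by rewrite EF; apply: eq_ideal_gen => h; split=> -[/HJ|]; [left|right|left|right].
(* An intersection over no lines is the unit ideal, so saturation is automatic. *)
have sat0 : saturated_wrt (@irrS k) (addI (Jv [::]) (prodF s)).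
  by move=> f _; apply: mem_ideal_gen; left.
split=> [cm|/(eq_saturated (fun f => iff_sym (satE f))) sat].
  apply: (eq_saturated satE).
  have [g fK gK] := cR_bij D0.
  (* [I0] is the ideal [(sigma, F)] of [Z_1]. Its depth 3 at the origin gives a chain of primes,
     which also lies over the ideal of [Z]; [cm] converts that chain into depth 3. *)
  pose I0 r := ext (planeI [::] s) (g r).
  have HI0 f : I0 (cR a b a' b' f) <-> ext (planeI [::] s) f by rewrite /I0 fK.
  have iI0 : is_ideal I0.
    exact: (ideal_iso (cR_bij D0) HI0 (ext_ideal (planeI_ideal [::] s))).
  have II0 : ideal_sub (fat_ideal Z) I0.
    move=> r; rewrite -[r]gK => /HI Ir; apply/HI0 => i.
    by have [_ Fi] := Ir i; split.
  have I0m : ideal_sub I0 (@origin k).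
    by move=> r; rewrite -[r]gK => /HI0; apply: origin_planeI.
  have mm := origin_maximal k; have pm := maximal_ideal_prime mm.
  have Im : ideal_sub (fat_ideal Z) (@origin k) by move=> r /II0 /I0m.
  have dep0 : depth_ge I0 (@origin k) 3.
    by apply: (depth_ge_saturated chark0 D0 HI0 _ sv s0 mm I0m sat0).
  have [P [prP ltP I0P Pm]] := depth_ge_dim_ge iI0 pm I0m dep0.
  have dep : depth_ge (fat_ideal Z) (@origin k) 3.
    by apply/(cm _ mm Im); exists P; split=> // r /II0 /I0P.
  exact: (saturated_of_depth chark0 D0 HI cv sv s0 dep).
(* Depth is at most dimension, the dimension is at most 3, and saturation gives depth 3. *)
move=> m mm Im n; have pm := maximal_ideal_prime mm.
split=> [|dim]; first exact: depth_ge_dim_ge.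
have n3 : (n <= 3)%N.
  by apply: dim_fat_ideal_le dim => // p pZ; case: okZ => H _; case: (H p pZ).
apply: (depth_ge_le pm n3 Im).
exact: (depth_ge_saturated chark0 D0 HI cv sv s0 mm Im sat).
Qed.
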